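(* Let $\Omega\subset\mathbb{R}^d$ be open and let $k:\mathbb{R}^d\times\mathbb{R}^d\to[0,\infty]$ be a measurable kernel satisfying conditions (SM), (K1) and (K2) (defined in the context). For $n\in\mathbb{N}$ let $D_n=\{(\mathbf{x},\mathbf{y})\in\mathbb{R}^d\times\mathbb{R}^d:|\mathbf{x}-\mathbf{y}|>1/n\}$ and let $$\mathbb{L}_n\mathbf{u}(\mathbf{x})=\int_{|\mathbf{x}-\mathbf{y}|>1/n}k(\mathbf{x},\mathbf{y})\,\mathcal{D}(\mathbf{u})(\mathbf{x},\mathbf{y})\,\frac{\mathbf{x}-\mathbf{y}}{|\mathbf{x}-\mathbf{y}|}\,d\mathbf{y},$$ $$\mathcal{F}^k_n(\mathbf{u},\mathbf{v})=\iint_{D_n}k(\mathbf{x},\mathbf{y})\,\mathcal{D}(\mathbf{u})(\mathbf{x},\mathbf{y})\left(\mathbf{v}(\mathbf{x})\cdot\frac{\mathbf{x}-\mathbf{y}}{|\mathbf{x}-\mathbf{y}|}\right)d\mathbf{y}\,d\mathbf{x}.$$ Then: (i) $(\mathbb{L}_n\mathbf{u},\mathbf{v})_{L^2(\mathbb{R}^d)}=\mathcal{F}^k_n(\mathbf{u},\mathbf{v})$ and $\lim_{n\to\infty}\mathcal{F}^k_n(\mathbf{u},\mathbf{v})=\mathcal{F}^k(\mathbf{u},\mathbf{v})$ for all $\mathbf{u},\mathbf{v}\in C_c^\infty(\Omega;\mathbb{R}^d)$; (ii) $\mathcal{F}^k:S(\mathbb{R}^d;k)\times S(\mathbb{R}^d;k)\to\mathbb{R}$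 is continuous, and thus it is also continuous on $S_\Omega(\mathbb{R}^d;k)$.
   Context: For $\mathbf{u}:\mathbb{R}^d\to\mathbb{R}^d$ and $\mathbf{x}\ne\mathbf{y}$, $\mathcal{D}(\mathbf{u})(\mathbf{x},\mathbf{y})=(\mathbf{u}(\mathbf{x})-\mathbf{u}(\mathbf{y}))\cdot\frac{\mathbf{x}-\mathbf{y}}{|\mathbf{x}-\mathbf{y}|}$. Set $k_s(\mathbf{x},\mathbf{y})=\frac12(k(\mathbf{x},\mathbf{y})+k(\mathbf{y},\mathbf{x}))$, $k_a(\mathbf{x},\mathbf{y})=\frac12(k(\mathbf{x},\mathbf{y})-k(\mathbf{y},\mathbf{x}))$. Condition (SM): $\mathbf{x}\mapsto\int_{\mathbb{R}^d}\min\{1,|\mathbf{x}-\mathbf{y}|^2\}k_s(\mathbf{x},\mathbf{y})\,d\mathbf{y}$ belongs to $L^1_{loc}(\mathbb{R}^d)$. $S(\mathbb{R}^d;k)=\{\mathbf{v}\in L^2(\mathbb{R}^d;\mathbb{R}^d):\mathcal{D}(\mathbf{v})k_s^{1/2}\in L^2(\mathbb{R}^d\times\mathbb{R}^d)\}$ with norm $\|\mathbf{v}\|^2_{S(\mathbb{R}^d;k)}=\|\mathbf{v}\|^2_{L^2(\mathbb{R}^d)}+\iint k_s(\mathbf{x},\mathbf{y})(\mathcal{D}(\mathbf{v})(\mathbf{x},\mathbf{y}))^2\,d\mathbf{y}\,d\mathbf{x}$; $S_\Omega(\mathbb{R}^d;k)$ is the subspace of those $\mathbf{v}\in S(\mathbb{R}^d;k)$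 with $\mathbf{v}=\mathbf{0}$ a.e. on $\mathbb{R}^d\setminus\Omega$, with the same norm. Conditions (K1), (K2): there exist a symmetric kernel $\tilde k:\mathbb{R}^d\times\mathbb{R}^d\to[0,\infty]$ and constants $A_1,A_2\ge1$ such that for all $\mathbf{x}\in\mathbb{R}^d$ the set $\{\mathbf{y}:k_a^2(\mathbf{x},\mathbf{y})\ne0,\ \tilde k(\mathbf{x},\mathbf{y})=0\}$ has measure zero, and (K1) $\iint\tilde k(\mathbf{x},\mathbf{y})(\mathcal{D}(\mathbf{u})(\mathbf{x},\mathbf{y}))^2\,d\mathbf{y}\,d\mathbf{x}\le A_1\|\mathbf{u}\|^2_{S(\mathbb{R}^d;k)}$ for all $\mathbf{u}\in S(\mathbb{R}^d;k)$; (K2) $\sup_{\mathbf{x}\in\mathbb{R}^d}\int_{\mathbb{R}^d}\frac{k_a^2(\mathbf{x},\mathbf{y})}{\tilde k(\mathbf{x},\mathbf{y})}\,d\mathbf{y}\le A_2$ (the integrand is read as $0$ where $k_a=0$). Bilinear form: $$\mathcal{F}^k(\mathbf{u},\mathbf{v})=\frac12\iint_{\mathbb{R}^d\times\mathbb{R}^d}k_s(\mathbf{x},\mathbf{y})\mathcal{D}(\mathbf{u})(\mathbf{x},\mathbf{y})\mathcal{D}(\mathbf{v})(\mathbf{x},\mathbf{y})\,d\mathbf{y}\,d\mathbf{x}+\iint_{\mathbb{R}^d\times\mathbb{R}^d}k_a(\mathbf{x},\mathbf{y})\mathcal{D}(\mathbf{u})(\mathbf{x},\mathbf{y})\left(\mathbf{v}(\mathbf{x})\cdot\frac{\mathbf{x}-\mathbf{y}}{|\mathbf{x}-\mathbf{y}|}\right)d\mathbf{y}\,d\mathbf{x}.$$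 $(\mathbf{w},\mathbf{v})_{L^2(\mathbb{R}^d)}$ denotes $\int_{\mathbb{R}^d}\mathbf{w}\cdot\mathbf{v}\,d\mathbf{x}$. *)

(* Defs.v *)
From HB Require Import structures.
From mathcomp Require Import all_boot all_order all_algebra.
From mathcomp Require Import all_classical all_reals all_analysis.
From mathcomp Require Import measurable_realfun.

Set Implicit Arguments.
Unset Strict Implicit.
Unset Printing Implicit Defensive.

Import Order.TTheory GRing.Theory Num.Theory.
Import numFieldNormedType.Exports.

Local Open Scope classical_set_scope.
Local Open Scope ring_scope.

Definition measure_rV_display : measure_display -> measure_display.
Proof. exact. Qed.

Section measurable_rV.
Context {d} {T : measurableType d}.
Variable n : nat.

Let coors : 'I_n -> 'rV[T]_n -> T := fun i x => x ord0 i.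

Let rV_set0 : g_sigma_preimage coors set0.
Proof. exact: sigma_algebra0. Qed.

Let rV_setC A : g_sigma_preimage coors A -> g_sigma_preimage coors (~` A).
Proof. exact: sigma_algebraC. Qed.

Let rV_bigcup (F : _^nat) : (forall i, g_sigma_preimage coors (F i)) ->
  g_sigma_preimage coors (\bigcup_i (F i)).
Proof. exact: sigma_algebra_bigcup. Qed.

HB.instance Definition _ := @isMeasurable.Build (measure_rV_display d)
  'rV[T]_n (g_sigma_preimage coors) rV_set0 rV_setC rV_bigcup.

Lemma measurable_coor (i : 'I_n) :
  measurable_fun [set: 'rV[T]_n] (fun x => x ord0 i).
Proof.
move=> _ Y mY; rewrite setTI; apply: sub_sigma_algebra => /=.
rewrite -bigcup_seq/=; exists i => /=; first by rewrite mem_index_enum.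
by exists Y => //; rewrite setTI.
Qed.

Lemma measurable_fun_coorP d1 (T1 : measurableType d1) (f : T1 -> 'rV[T]_n) :
  measurable_fun [set: T1] f <->
  forall i, measurable_fun [set: T1] (fun x => f x ord0 i).
Proof.
split=> [mf i|mf]; first exact: (measurableT_comp (measurable_coor i)).
rewrite /measurable_fun => _ A.
rewrite setTI.
have H : g_sigma_preimage coors `<=` [set A | measurable (f @^-1` A)].
  apply: smallest_sub.
    split => /=.
    - by rewrite preimage_set0.
    - by move=> B mB; rewrite setTD preimage_setC; exact: measurableC.
    - by move=> F mF; rewrite preimage_bigcup; exact: bigcupT_measurable.
  move=> B; rewrite -bigcup_seq => -[i _ [C mC <-]] /=.
  by rewrite setTI -[X in measurable X]setTI; exact: (mf i).
exact: H.
Qed.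

End measurable_rV.

(* The library's sigma-finite instance on m1 \x m2 is shadowed by the later
   subprobability instance, hence this direct statement. *)
Lemma product_sigma_finite d1 d2 (T1 : measurableType d1)
    (T2 : measurableType d2) (R : realType)
    (m1 : {sigma_finite_measure set T1 -> \bar R})
    (m2 : {sigma_finite_measure set T2 -> \bar R}) :
  sigma_finite setT (m1 \x m2)%E.
Proof.
have /sigma_finiteP[F [TF ndF Foo]] := sigma_finiteT m1.
have /sigma_finiteP[G [TG ndG Goo]] := sigma_finiteT m2.
exists (fun n => F n `*` G n).
  rewrite -setXTT TF TG predeqE => -[x y]; split.
    move=> [/= [n _ Fnx] [k _ Gky]]; exists (maxn n k) => //; split.
    - by move: x Fnx; exact/subsetPset/ndF/leq_maxl.
    - by move: y Gky; exact/subsetPset/ndG/leq_maxr.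
  by move=> [n _ []/= ? ?]; split; exists n.
move=> k; have [? ?] := Foo k; have [? ?] := Goo k.
split; first exact: measurableX.
by rewrite product_measure1E// lte_mul_pinfty// ge0_fin_numE.
Qed.

Section lebesgue_rV.
Context {R : realType}.

Definition rV_cons n (p : measurableTypeR R * 'rV[R]_n) : 'rV[R]_n.+1 :=
  \row_i (if unlift ord0 i is Some j then p.2 ord0 j else p.1).

Definition rV_uncons n (x : 'rV[R]_n.+1) : measurableTypeR R * 'rV[R]_n :=
  (x ord0 ord0, \row_j x ord0 (lift ord0 j)).

Lemma rV_consK n : cancel (@rV_cons n) (@rV_uncons n).
Proof.
move=> [a v]; rewrite /rV_cons /rV_uncons mxE unlift_none/=; congr (_, _).
by apply/rowP => j; rewrite !mxE liftK.
Qed.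

Lemma measurable_rV_cons n : measurable_fun setT (@rV_cons n).
Proof.
apply/measurable_fun_coorP => i; rewrite /rV_cons.
case: (unliftP ord0 i) => [j ->|->].
  rewrite [X in measurable_fun _ X](_ : _ = (fun x : 'rV[R]_n => x ord0 j) \o snd).
    by apply: measurableT_comp => //; exact: measurable_coor.
  by apply/funext => p /=; rewrite mxE liftK.
rewrite [X in measurable_fun _ X](_ : _ = fst)//.
by apply/funext => p /=; rewrite mxE unlift_none.
Qed.

Lemma measurable_rV_uncons n : measurable_fun setT (@rV_uncons n).
Proof.
apply: measurable_fun_pair; first exact: measurable_coor.
apply/measurable_fun_coorP => j.
rewrite [X in measurable_fun _ X](_ : _ =
  fun x : 'rV[R]_n.+1 => x ord0 (lift ord0 j)).
  exact: measurable_coor.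
by apply/funext => x; rewrite mxE.
Qed.

Section step.
Local Open Scope ereal_scope.
Variables (n : nat) (mu : {sigma_finite_measure set 'rV[R]_n -> \bar R}).

Definition lebesgue_step : set 'rV[R]_n.+1 -> \bar R :=
  pushforward (@lebesgue_measure R \x mu) (@rV_cons n).

Let lebesgue_step0 : lebesgue_step set0 = 0.
Proof. by rewrite /lebesgue_step /pushforward preimage_set0 measure0. Qed.

Let lebesgue_step_ge0 A : 0 <= lebesgue_step A.
Proof. by rewrite /lebesgue_step /pushforward measure_ge0. Qed.

Let lebesgue_step_sigma_additive : semi_sigma_additive lebesgue_step.
Proof.
move=> F mF tF mUF; rewrite /lebesgue_step /pushforward preimage_bigcup.
have mcons (A : set 'rV[R]_n.+1) : measurable A -> measurable (@rV_cons n @^-1` A).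
  by move=> mA; rewrite -[X in measurable X]setTI; exact: measurable_rV_cons.
apply: measure_semi_sigma_additive.
- by move=> k; exact: mcons.
- apply/trivIsetP => /= i j _ _ ij; rewrite -preimage_setI.
  by move/trivIsetP : tF => /(_ _ _ _ _ ij) ->//; rewrite preimage_set0.
- by rewrite -preimage_bigcup; exact: mcons.
Qed.

HB.instance Definition _ := isMeasure.Build _ _ _ lebesgue_step
  lebesgue_step0 lebesgue_step_ge0 lebesgue_step_sigma_additive.

Let lebesgue_step_sigma_finite : sigma_finite setT lebesgue_step.
Proof.
have [F TF Foo] := product_sigma_finite (@lebesgue_measure R) mu.
exists (fun k => @rV_uncons n @^-1` F k).
  by rewrite -preimage_bigcup -TF preimage_setT.
move=> k; have [mF Fk] := Foo k; split.
  by rewrite -[X in measurable X]setTI; exact: measurable_rV_uncons.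
rewrite /lebesgue_step /pushforward -comp_preimage.
rewrite (_ : _ \o _ = id) ?preimage_id//.
by apply/funext => p /=; rewrite rV_consK.
Qed.

HB.instance Definition _ := Measure_isSigmaFinite.Build _ _ _ lebesgue_step
  lebesgue_step_sigma_finite.

End step.

(* Lebesgue measure on R^n, on the Borel sets; lebesgue_rV_box below is its
   value on boxes. *)
Fixpoint lebesgue_rV n : {sigma_finite_measure set 'rV[R]_n -> \bar R} :=
  match n with
  | 0 => \d_ (0 : 'rV[R]_0)
  | n.+1 => lebesgue_step (lebesgue_rV n)
  end.

Lemma lebesgue_rV_box n (A : 'I_n -> set R) : (forall i, measurable (A i)) ->
  lebesgue_rV n [set x | forall i, A i (x ord0 i)] =
  (\prod_(i < n) lebesgue_measure (A i))%E.
Proof.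
elim: n A => [|n IHn] A mA.
  rewrite big_ord0 /= diracE mem_set//.
  by move=> [].
rewrite big_ord_recl -IHn; last by move=> i; exact: mA.
rewrite /= /lebesgue_step /pushforward -product_measure1E; first last.
- rewrite [X in measurable X](_ : _ =
    \bigcap_(i in [set: 'I_n]) ((fun x : 'rV[R]_n => x ord0 i) @^-1` A (lift ord0 i))).
    apply: fin_bigcap_measurable => // i _.
    by rewrite -[X in measurable X]setTI; exact: (measurable_coor i).
  by apply/seteqP; split=> [x H i _|x H i]; exact: H.
- exact: mA.
congr (product_measure1 _ _ _); apply/seteqP; split=> [[a v] H|[a v] [H1 H2] i] /=.
  split=> [|i] /=.
    by move: (H ord0); rewrite mxE unlift_none.
  by move: (H (lift ord0 i)); rewrite mxE liftK.
by rewrite mxE; case: (unliftP ord0 i) => [j ->|->].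
Qed.

End lebesgue_rV.

Section smooth.
Context {R : realType}.
Variable d : nat.
Local Notation Rd := 'rV[R]_d.

Fixpoint Ck (m : nat) (f : Rd -> Rd) : Prop :=
  match m with
  | 0 => continuous f
  | m.+1 => continuous f /\ forall i : 'I_d,
      (forall x, derivable f x (delta_mx ord0 i)) /\
      Ck m (fun x => 'D_(delta_mx ord0 i) f x)
  end.

Definition support (f : Rd -> Rd) : set Rd := closure [set x | f x != 0].

Definition Cc_smooth (Omega : set Rd) (f : Rd -> Rd) : Prop :=
  [/\ forall m, Ck m f, compact (support f) & support f `<=` Omega].

End smooth.

Section nonlocal.
Context {R : realType}.
Variable d : nat.
Local Notation Rd := 'rV[R]_d.
Local Notation vfield := ('rV[R]_d -> 'rV[R]_d).
Local Notation leb := (@lebesgue_rV R d).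
Local Notation leb2 := (@lebesgue_rV R d \x @lebesgue_rV R d)%E.

Definition dotp (a b : Rd) : R := \sum_(i < d) a ord0 i * b ord0 i.

(* The library's norm on 'rV[R]_d is the sup norm. *)
Definition enorm (a : Rd) : R := Num.sqrt (dotp a a).

Definition dir (z : Rd * Rd) : Rd := (enorm (z.1 - z.2))^-1 *: (z.1 - z.2).

(* Equal to 0 on the diagonal, since 0^-1 = 0. *)
Definition Dop (u : vfield) (z : Rd * Rd) : R := dotp (u z.1 - u z.2) (dir z).

Local Open Scope ereal_scope.

Variable k : Rd * Rd -> \bar R.

Definition ksym (z : Rd * Rd) : \bar R := (2^-1)%:E * (k z + k (z.2, z.1)).

(* The test only matters when both values are +oo, where the difference is
   undefined and 0 is chosen. *)
Definition kanti (z : Rd * Rd) : \bar R :=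
  if k z == k (z.2, z.1) then 0 else (2^-1)%:E * (k z - k (z.2, z.1)).

Definition L1loc (f : Rd -> \bar R) : Prop :=
  forall K : set Rd, compact K -> leb.-integrable K f.

Definition L2 dT (T : measurableType dT) (mu : set T -> \bar R)
    (f : T -> \bar R) : Prop :=
  measurable_fun [set: T] f /\ (\int[mu]_x (f x ^+ 2)) < +oo.

Definition condSM : Prop :=
  L1loc (fun x => \int[leb]_y
    ((Num.min 1 (enorm (x - y) ^+ 2))%:E * ksym (x, y))).

Definition Sspace : set vfield :=
  [set v | [/\ measurable_fun [set: Rd] v,
     L2 leb (fun x => (enorm (v x))%:E) &
     L2 leb2 (fun z => (Dop v z)%:E * sqrte (ksym z))]].

Definition Ssqnorm (v : vfield) : \bar R :=
  (\int[leb]_x (enorm (v x) ^+ 2)%:E) +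
  (\int[leb2]_z (ksym z * (Dop v z ^+ 2)%:E)).

Definition Snorm (v : vfield) : R := Num.sqrt (fine (Ssqnorm v)).

Definition Sspace_on (Omega : set Rd) : set vfield :=
  [set v | Sspace v /\ {ae leb, forall x, ~ Omega x -> v x = 0%R}].

(* In the supremum, (+oo)^-1 = 0 and 0 * +oo = 0, so the integrand
   vanishes where kanti does. *)
Definition condK (kt : Rd * Rd -> \bar R) (A1 A2 : R) : Prop :=
  [/\ forall x, leb [set y | kanti (x, y) ^+ 2 != 0 /\ kt (x, y) = 0] = 0,
      forall u, Sspace u ->
        (\int[leb2]_z (kt z * (Dop u z ^+ 2)%:E)) <= A1%:E * Ssqnorm u &
      ereal_sup [set \int[leb]_y (kanti (x, y) ^+ 2 * (kt (x, y))^-1)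
                | x in [set: Rd]] <= A2%:E].

Definition condK12 : Prop :=
  exists (kt : Rd * Rd -> \bar R) (A1 A2 : R),
    [/\ [/\ measurable_fun [set: Rd * Rd] kt,
            forall z, 0 <= kt z &
            forall x y, kt (x, y) = kt (y, x)],
        (1 <= A1)%R, (1 <= A2)%R & condK kt A1 A2].

Definition Fsym_integrand (u v : vfield) (z : Rd * Rd) : \bar R :=
  ksym z * (Dop u z * Dop v z)%:E.

Definition Fanti_integrand (u v : vfield) (z : Rd * Rd) : \bar R :=
  kanti z * (Dop u z * dotp (v z.1) (dir z))%:E.

Definition Fform_defined (u v : vfield) : Prop :=
  leb2.-integrable [set: Rd * Rd] (Fsym_integrand u v) /\
  leb2.-integrable [set: Rd * Rd] (Fanti_integrand u v).

Definition Fform (u v : vfield) : R :=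
  (2^-1 * fine (\int[leb2]_z Fsym_integrand u v z) +
   fine (\int[leb2]_z Fanti_integrand u v z))%R.

Definition Dset (n : nat) : set (Rd * Rd) :=
  [set z | n%:R^-1 < enorm (z.1 - z.2)]%R.

Definition Fn_integrand (u v : vfield) (z : Rd * Rd) : \bar R :=
  k z * (Dop u z * dotp (v z.1) (dir z))%:E.

Definition Fn_defined (n : nat) (u v : vfield) : Prop :=
  leb2.-integrable (Dset n) (Fn_integrand u v).

Definition Fn (n : nat) (u v : vfield) : R :=
  fine (\int[leb2]_(z in Dset n) Fn_integrand u v z).

Definition Ln_integrand (u : vfield) (x : Rd) (i : 'I_d) (y : Rd) : \bar R :=
  k (x, y) * (Dop u (x, y) * dir (x, y) ord0 i)%:E.

Definition Ln_domain (n : nat) (x : Rd) : set Rd :=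
  [set y | n%:R^-1 < enorm (x - y)]%R.

Definition Ln_defined (n : nat) (u : vfield) (x : Rd) : Prop :=
  forall i, leb.-integrable (Ln_domain n x) (Ln_integrand u x i).

Definition Ln (n : nat) (u : vfield) (x : Rd) : Rd :=
  \row_i fine (\int[leb]_(y in Ln_domain n x) Ln_integrand u x i y).

End nonlocal.

Definition L2pair_defined (R : realType) d (w v : 'rV[R]_d -> 'rV[R]_d) : Prop :=
  (@lebesgue_rV R d).-integrable setT (fun x => (dotp (w x) (v x))%:E).

Definition L2pair (R : realType) d (w v : 'rV[R]_d -> 'rV[R]_d) : R :=
  \int[@lebesgue_rV R d]_x dotp (w x) (v x).

(* X carries the topology of the seminorm N, X * X the product topology. *)
Definition form_continuous (R : realType) (T : Type) (V : zmodType)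
    (X : set (T -> V)) (N : (T -> V) -> R) (F : (T -> V) -> (T -> V) -> R) :=
  forall u0 v0, X u0 -> X v0 -> forall e : R, 0 < e ->
    exists2 delta : R, 0 < delta & forall u v, X u -> X v ->
      N (u \- u0) < delta -> N (v \- v0) < delta ->
      `|F u v - F u0 v0| < e.

(* Main.v *)
(* The antisymmetric part is controlled by the weighted inequality
   2 |k_a D(u) v.e| <= t k~ D(u)^2 + t^-1 (k_a^2 / k~) |v|^2, which holds
   pointwise in [0, +oo] with no exceptional set; integrating it, (K1) and (K2)
   give |F(u, v)| <= C (t |u|^2 + t^-1 |v|^2) for every t > 0, hence continuity.
   All integrands become real-valued almost everywhere because D(u) vanishes a.e.
   where k_s = +oo.  For test functions |D(u)| <= C min(1, |x - y|), so (SM)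
   puts them in S(R^d; k) and justifies Fubini on D_n, where
   k <= 2 n^2 min(1, |x - y|^2) k_s.  Writing k = k_s + k_a and exchanging x and y
   in the k_s part turns F_n into the integral over D_n of the integrands of F,
   and dominated convergence applies. *)
Require Import Defs.
From mathcomp Require Import all_boot all_order all_algebra.
From mathcomp Require Import all_classical all_reals all_analysis.
From mathcomp Require Import measurable_realfun.
From mathcomp Require Import ring lra.
Import Order.TTheory GRing.Theory Num.Theory.
Import numFieldNormedType.Exports.
Local Open Scope classical_set_scope.
Local Open Scope ring_scope.

(** * Borel measurability on [R^d] *)

Section measurability.
Context {R : realType}.

(** The obstacle is the diagonal. The integrand of F_n pairs k with a single difference D(u) = O(|x
    - y|), whereas (SM) controls only |x - y|^2 k_s, so no bound uniform in n can be read off from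
    it. Averaging the k_s part with its swap replaces v(x).e by D(v)/2 and supplies the missing
    power of |x - y|; the k_a part admits no such gain and owes its integrability to (K1) and (K2)
    alone.

    The free weight t plays the part of the Cauchy-Schwarz inequality: minimizing t a + b/t over t
    gives a multiple of sqrt(a b), and keeping t avoids products and square roots of possibly
    infinite integrals.

    Bounds are proved in the extended reals, where nonnegative integrands need no finiteness.
    Linearity does need it, since a difference of infinite values is meaningless; it is proved on
    real-valued versions of the integrands that agree with the originals almost everywhere. *)

Lemma measurable_invr : measurable_fun [set: R] (@GRing.inv R).
Proof.
(* Inversion is discontinuous only at 0, where its value is 0 by convention; isolating this point
   leaves a continuous function on an open set. *)
rewrite (_ : GRing.inv = fun x : R => if x == 0 then 0 else x^-1); last first.
  by apply/funext => x; case: eqP => // ->; rewrite invr0.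
apply: measurable_fun_if => //.
- exact: measurable_fun_eqr.
- rewrite setTI (_ : _ @^-1` _ = [set~ 0]).
    apply: open_continuous_measurable_fun; first exact: closed_openC.
    by move=> x; rewrite inE => /eqP; exact: inv_continuous.
  by apply/seteqP; split => x /=; case: eqP.
Qed.

Lemma measurable_inve : measurable_fun [set: \bar R] (@inve R).
Proof.
rewrite (_ : inve = fun x : \bar R => if x == 0%E then +oo%E else
  if x \is a fin_num then (fine x)^-1%:E else if x == +oo%E then 0%E else -oo%E).
  apply: measurable_fun_ifT => //; first exact: measurable_fun_eqe.
  apply: measurable_fun_ifT => //.
  - by apply: (measurable_fun_bool true); exact/emeasurable_fin_num.
  - by apply/measurable_EFinP; apply: measurableT_comp => //; exact: measurable_invr.
  - apply: measurable_fun_ifT => //; exact: measurable_fun_eqe.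
by apply/funext; case => [r| |] //=; rewrite inver eqe.
Qed.

Lemma measurable_sqrtr : measurable_fun [set: R] (@Num.sqrt R).
Proof. by apply: continuous_measurable_fun; exact: sqrt_continuous. Qed.

Lemma measurable_sqrte d (T : measurableType d) (f : T -> \bar R) :
  (forall x, 0 <= f x)%E -> measurable_fun [set: T] f ->
  measurable_fun [set: T] (fun x => sqrte (f x)).
Proof.
(* The two functions can differ only at -oo, which nonnegativity excludes. *)
move=> f0 mf; rewrite (_ : (fun _ => _) = er_map Num.sqrt \o f); last first.
  by apply/funext => x /=; case: (f x) (f0 x).
by apply: measurableT_comp => //; exact: (@measurable_er_map _ T _ _ measurable_sqrtr).
Qed.

End measurability.

Section borel_rV.
Context {R : realType} {d : nat}.
Local Notation Rd := 'rV[R]_d.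

(** The sigma-algebra is generated by the coordinates and the topology by the sup norm. They are
    linked by cubes with rational centre and half-width [1/(m+1)]: there are countably many, and an
    open set is the union of those it contains. *)
Lemma open_measurable_rV (A : set Rd) : open A -> measurable A.
Proof.
move=> oA.
pose C (c : 'rV[rat]_d * nat) : set Rd :=
  [set y | forall i, `|ratr (c.1 ord0 i) - y ord0 i| < c.2.+1%:R^-1].
have mC c : measurable (C c).
  rewrite (_ : C c = \bigcap_(i in [set: 'I_d])
     ((fun x : Rd => x ord0 i) @^-1` ball (ratr (c.1 ord0 i) : R) c.2.+1%:R^-1)).
    apply: fin_bigcap_measurable => // i _.
    rewrite -[X in measurable X]setTI; apply: (@measurable_coor _ R d i) => //.
    exact: measurable_ball.
  by apply/seteqP; split=> [x H i _|x H i]; exact: H.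
rewrite (_ : A = \bigcup_c (if `[< C c `<=` A >] then C c else set0)).
  apply: countable_bigcupT_measurable => [|c]; first exact: countableP.
  by case: ifP.
apply/seteqP; split => [x Ax|x [c _]]; last first.
  by case: ifPn => // /asboolP; exact.
move: (oA); rewrite openE => /(_ _ Ax)/nbhs_ballP[e /= e0 xeA].
(* The centre lies within [1/(n+1)] of [x] and each point of the cube within [1/(n+1)] of the
   centre, so twice this width must stay below [e]. *)
have [n ne] : exists n : nat, n.+1%:R^-1 < e / 2.
  exists (Num.truncn (e / 2)^-1).
  rewrite -[ltRHS]invrK ltf_pV2 ?posrE ?invr_gt0 ?divr_gt0//.
  exact: truncnS_gt.
have q_ (i : 'I_d) : exists q : rat, `|ratr q - x ord0 i| < n.+1%:R^-1 :> R.
  have /rat_in_itvoo[q /itvP qx] : x ord0 i < x ord0 i + n.+1%:R^-1.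
    by rewrite ltrDl invr_gt0.
  exists q; rewrite ltr_distl qx andbT (lt_trans _ (_ : x ord0 i < _)) ?qx//.
  by rewrite ltrBlDr ltrDl invr_gt0.
have [q qx] := choice q_.
exists (\row_i q i, n) => //.
case: ifPn => [_ i /=|/asboolP]; first by rewrite mxE.
case=> y Cy; apply: xeA; split => // i j.
rewrite (ord1 i) /ball /= (splitr e).
rewrite -(subrKA (ratr (q j))) (le_lt_trans (ler_normD _ _))// ltrD//.
  by rewrite distrC (lt_trans (qx j)).
by have := Cy j; rewrite /= mxE => /lt_trans; apply.
Qed.

Lemma continuous_measurable_rV (f : Rd -> R) :
  continuous f -> measurable_fun [set: Rd] f.
Proof.
move=> /continuousP cf; apply: (measurability _ (RGenOpens.measurableE R)).
move=> _ [_ [a [b ->] <-]]; rewrite setTI; apply: open_measurable_rV.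
exact/cf/interval_open.
Qed.

Lemma continuous_coor (f : Rd -> Rd) i :
  continuous f -> continuous (fun x => f x ord0 i).
Proof.
by move=> cf x; apply: (@continuous_comp _ _ _ f (fun x : Rd => x ord0 i));
  [exact: cf|exact: coord_continuous].
Qed.

Lemma continuous_measurable_vfield (f : Rd -> Rd) :
  continuous f -> measurable_fun [set: Rd] f.
Proof.
move=> cf; apply/measurable_fun_coorP => i; apply: continuous_measurable_rV.
exact: continuous_coor.
Qed.

(** Closed cubes exhaust the space by compact sets of finite measure; local integrability and
    compact support are both used through them. *)
Definition box (N : nat) : set Rd := [set x | forall i, x ord0 i \in `[(- N%:R), N%:R]].

Lemma compact_box N : compact (box N).
Proof.
rewrite /box; apply: (@rV_compact R _ (fun=> `[(- N%:R : R), N%:R]%classic)) => i.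
exact: segment_compact.
Qed.

Lemma measurable_box N : measurable (box N).
Proof.
rewrite (_ : box N = \bigcap_(i in [set: 'I_d])
    ((fun x : Rd => x ord0 i) @^-1` `[(- N%:R), N%:R]%classic)).
  apply: fin_bigcap_measurable => // i _.
  by rewrite -[X in measurable X]setTI; apply: (@measurable_coor _ R d i).
by apply/seteqP; split=> [x H i _|x H i]; exact: H.
Qed.

Lemma lebesgue_box_lty N : (lebesgue_rV d (box N) < +oo)%E.
Proof.
rewrite /box (lebesgue_rV_box (A := fun=> `[(- N%:R), N%:R]%classic))//.
rewrite big_const_ord; elim: d => [|n IHn] /=; first exact: ltry.
rewrite lte_mul_pinfty// lebesgue_measure_itv/=; by case: ifP => // _; rewrite ?ltry.
Qed.

Lemma box_cover (x : Rd) : exists N, box N x.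
Proof.
exists (\max_(i < d) (Num.truncn `|x ord0 i|%R).+1) => i; rewrite in_itv /= -ler_norml.
apply: (@le_trans _ _ (Num.truncn `|x ord0 i|%R).+1%:R).
  by rewrite ltW// truncnS_gt.
rewrite ler_nat.
by apply: (leq_bigmax_cond (F := fun i => (Num.truncn `|x ord0 i|%R).+1)).
Qed.

Lemma coor_le_norm (x : Rd) j : `|x ord0 j| <= `|x|.
Proof.
rewrite [leRHS]/Num.norm /= mx_normrE.
by apply/bigmax_geP; right => /=; exists (ord0, j).
Qed.

Lemma compact_sub_box (K : set Rd) : compact K -> exists N, K `<=` box N.
Proof.
move=> /compact_bounded[M [Mr H]].
exists (Num.truncn (`|M| + 1)).+1 => x Kx i; rewrite in_itv /= -ler_norml.
have /H /(_ _ Kx) nx : M < `|M| + 1 by rewrite (le_lt_trans (ler_norm M))// ltrDl.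
rewrite (le_trans _ (ltW (truncnS_gt _)))// (le_trans _ nx)//.
exact: coor_le_norm.
Qed.

End borel_rV.

(** * The directional difference operator *)

Section dotp_theory.
Context {R : realType} {d : nat}.
Local Notation Rd := 'rV[R]_d.
Local Notation vfield := (Rd -> Rd).
Implicit Types (a b c : Rd) (z : Rd * Rd) (u v : vfield).

Lemma dotpC a b : dotp a b = dotp b a.
Proof. by apply: eq_bigr => i _; rewrite mulrC. Qed.

Lemma dotpDl a b c : dotp (a + b) c = dotp a c + dotp b c.
Proof. by rewrite /dotp -big_split; apply: eq_bigr => i _; rewrite mxE mulrDl. Qed.

Lemma dotpZl (t : R) a b : dotp (t *: a) b = t * dotp a b.
Proof. by rewrite /dotp mulr_sumr; apply: eq_bigr => i _; rewrite mxE mulrA. Qed.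

Lemma dotp0l a : dotp 0 a = 0.
Proof. by rewrite -(scale0r a) dotpZl mul0r. Qed.

Lemma dotpNl a b : dotp (- a) b = - dotp a b.
Proof. by rewrite -scaleN1r dotpZl mulN1r. Qed.

Lemma dotpBl a b c : dotp (a - b) c = dotp a c - dotp b c.
Proof. by rewrite dotpDl dotpNl. Qed.

Lemma dotpZr (t : R) a b : dotp a (t *: b) = t * dotp a b.
Proof. by rewrite dotpC dotpZl dotpC. Qed.

Lemma dotpNr a b : dotp a (- b) = - dotp a b.
Proof. by rewrite dotpC dotpNl dotpC. Qed.

Lemma dotpBr a b c : dotp a (b - c) = dotp a b - dotp a c.
Proof. by rewrite dotpC dotpBl !(dotpC a). Qed.

Lemma dotp_ge0 a : 0 <= dotp a a.
Proof. by apply: sumr_ge0 => i _; rewrite -expr2 sqr_ge0. Qed.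

Lemma enorm_ge0 a : 0 <= enorm a.
Proof. exact: sqrtr_ge0. Qed.

Lemma enorm_sqr a : enorm a ^+ 2 = dotp a a.
Proof. by rewrite sqr_sqrtr ?dotp_ge0. Qed.

Lemma enorm0 : enorm (0 : Rd) = 0.
Proof. by rewrite /enorm -(scale0r 0) dotpZl mul0r sqrtr0. Qed.

Lemma enormN a : enorm (- a) = enorm a.
Proof. by rewrite /enorm dotpNl dotpNr opprK. Qed.

Lemma enormD_sqr a b : enorm (a + b) ^+ 2 <= 2 * (enorm a ^+ 2 + enorm b ^+ 2).
Proof.
rewrite !enorm_sqr /dotp -big_split mulr_sumr; apply: ler_sum => i _.
rewrite mxE /= -!expr2 -subr_ge0.
by rewrite (_ : _ - _ = (a ord0 i - b ord0 i) ^+ 2) ?sqr_ge0//; ring.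
Qed.

(** Equality holds off the diagonal; on the diagonal [dir] is 0, hence only an inequality. *)
Lemma dir_dotp_le1 z : dotp (dir z) (dir z) <= 1.
Proof.
rewrite /dir dotpZl dotpZr -enorm_sqr.
have [->|n0] := eqVneq (enorm (z.1 - z.2)) 0; first by rewrite invr0 !mul0r.
by rewrite expr2 !mulrA divfK// mulVf.
Qed.

(* Expand 0 <= |a - c dir|^2 with c = a . dir. *)
Lemma dotp_dir_sqr_le a z : dotp a (dir z) ^+ 2 <= enorm a ^+ 2.
Proof.
have E (c : R) : dotp (a - c *: dir z) (a - c *: dir z) =
    dotp a a - 2 * c * dotp a (dir z) + c ^+ 2 * dotp (dir z) (dir z).
  rewrite dotpBl !dotpBr dotpZr dotpZl dotpZl dotpZr (dotpC (dir z) a); ring.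
have := dotp_ge0 (a - dotp a (dir z) *: dir z); rewrite E enorm_sqr.
set c := dotp a (dir z); have := dir_dotp_le1 z; set D := dotp (dir z) (dir z).
move=> D1; have : c ^+ 2 * D <= c ^+ 2 by rewrite ler_piMr// sqr_ge0.
rewrite -(mulrA 2) -expr2; lra.
Qed.

Lemma dir_swap z : dir (z.2, z.1) = - dir z.
Proof. by rewrite /dir /= -opprB enormN scalerN. Qed.

Lemma Dop_swap u z : Dop u (z.2, z.1) = Dop u z.
Proof. by rewrite /Dop dir_swap dotpNr /= -dotpNl opprB. Qed.

Lemma Dop_sub u v z : Dop (u \- v) z = Dop u z - Dop v z.
Proof.
by rewrite /Dop -dotpBl; congr dotp; rewrite /= !opprD !opprK addrACA. Qed.

(** Exhibits D(u) as [u(x) . dir] plus its image under the exchange of x and y, which is what the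
    symmetrization of F_n needs. It also shows that D(u) vanishes where [u] is zero at both
    points. *)
Lemma DopE u z : Dop u z = dotp (u z.1) (dir z) + dotp (u z.2) (dir (z.2, z.1)).
Proof. by rewrite /Dop dir_swap dotpNr dotpBl. Qed.

End dotp_theory.

Section vfield_measurability.
Context {R : realType} {d : nat}.
Local Notation Rd := 'rV[R]_d.
Context {dT : measure_display} {T : measurableType dT}.

Lemma measurable_coordP (f : T -> Rd) i : measurable_fun [set: T] f ->
  measurable_fun [set: T] (fun x => f x ord0 i).
Proof. by move=> mf; exact: (measurableT_comp (@measurable_coor _ R d i)). Qed.

Lemma measurable_rVD (f g : T -> Rd) : measurable_fun [set: T] f ->
  measurable_fun [set: T] g -> measurable_fun [set: T] (fun x => f x + g x).
Proof.
move=> mf mg; apply/measurable_fun_coorP => i.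
under eq_fun do rewrite mxE.
by apply: measurable_funD; exact: measurable_coordP.
Qed.

Lemma measurable_rVN (f : T -> Rd) : measurable_fun [set: T] f ->
  measurable_fun [set: T] (fun x => - f x).
Proof.
move=> mf; apply/measurable_fun_coorP => i.
under eq_fun do rewrite mxE.
by apply: measurable_funN; exact: measurable_coordP.
Qed.

Lemma measurable_rVB (f g : T -> Rd) : measurable_fun [set: T] f ->
  measurable_fun [set: T] g -> measurable_fun [set: T] (fun x => f x - g x).
Proof. by move=> mf mg; apply: measurable_rVD => //; exact: measurable_rVN. Qed.

Lemma measurable_rVZ (f : T -> R) (g : T -> Rd) : measurable_fun [set: T] f ->
  measurable_fun [set: T] g -> measurable_fun [set: T] (fun x => f x *: g x).
Proof.
move=> mf mg; apply/measurable_fun_coorP => i.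
under eq_fun do rewrite mxE.
by apply: measurable_funM => //; exact: measurable_coordP.
Qed.

Lemma measurable_dotp (f g : T -> Rd) : measurable_fun [set: T] f ->
  measurable_fun [set: T] g -> measurable_fun [set: T] (fun x => dotp (f x) (g x)).
Proof.
move=> mf mg; rewrite /dotp; apply: measurable_sum => i.
by apply: measurable_funM; exact: measurable_coordP.
Qed.

Lemma measurable_enorm (f : T -> Rd) : measurable_fun [set: T] f ->
  measurable_fun [set: T] (fun x => enorm (f x)).
Proof.
by move=> mf; apply: (measurableT_comp measurable_sqrtr); exact: measurable_dotp.
Qed.

End vfield_measurability.

Section Dop_measurability.
Context {R : realType} {d : nat}.
Local Notation Rd := 'rV[R]_d.
Local Notation vfield := (Rd -> Rd).

Lemma measurable_dir : measurable_fun [set: Rd * Rd] (@dir R d).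
Proof.
apply: measurable_rVZ; last exact: measurable_rVB.
apply: (measurableT_comp measurable_invr); apply: measurable_enorm.
exact: measurable_rVB.
Qed.

Lemma measurable_Dop (u : vfield) : measurable_fun [set: Rd] u ->
  measurable_fun [set: Rd * Rd] (Dop u).
Proof.
move=> mu; apply: measurable_dotp; last exact: measurable_dir.
by apply: measurable_rVB; exact: measurableT_comp.
Qed.

Lemma measurable_dotp_dir (v : vfield) : measurable_fun [set: Rd] v ->
  measurable_fun [set: Rd * Rd] (fun z => dotp (v z.1) (dir z)).
Proof.
move=> mv; apply: measurable_dotp; last exact: measurable_dir.
exact: measurableT_comp.
Qed.

Lemma measurable_Dset n : measurable (@Dset R d n).
Proof.
have /(_ measurableT [set true] I) : measurable_fun [set: Rd * Rd]
    (fun z => n%:R^-1 < enorm (z.1 - z.2)).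
  by apply: measurable_fun_ltr => //; apply: measurable_enorm; exact: measurable_rVB.
by rewrite setTI.
Qed.

Variable k : Rd * Rd -> \bar R.
Hypothesis mk : measurable_fun [set: Rd * Rd] k.

Lemma measurable_swapped dT (T : measurableType dT) (f : Rd * Rd -> T) :
  measurable_fun [set: Rd * Rd] f ->
  measurable_fun [set: Rd * Rd] (fun z => f (z.2, z.1)).
Proof. by move=> mf; apply: (measurableT_comp mf); exact: measurable_swap. Qed.

Lemma measurable_ksym : measurable_fun [set: Rd * Rd] (ksym k).
Proof.
apply: measurable_funeM; apply: emeasurable_funD => //.
exact: measurable_swapped.
Qed.

Lemma measurable_kanti : measurable_fun [set: Rd * Rd] (kanti k).
Proof.
apply: measurable_fun_ifT => //.
  by apply: measurable_fun_eqe => //; exact: measurable_swapped.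
apply: measurable_funeM; apply: emeasurable_funB => //.
exact: measurable_swapped.
Qed.

End Dop_measurability.

(** * Pointwise bounds on the kernel *)

Section weighted_am_gm.
Context {R : realType}.
Local Open Scope ereal_scope.

Lemma am_gm_real (t a b : R) :
  (0 < t -> `|a * b| <= t / 2 * a ^+ 2 + t^-1 / 2 * b ^+ 2)%R.
Proof.
move=> t0; rewrite normrM -(real_normK (num_real a)) -(real_normK (num_real b)).
set x := `|a|%R; set y := `|b|%R; rewrite -subr_ge0.
rewrite (_ : (_ - _)%R = (t^-1 / 2 * (t * x - y) ^+ 2)%R); last first.
  by field; rewrite gt_eqF.
by rewrite mulr_ge0 ?sqr_ge0// divr_ge0// invr_ge0 ltW.
Qed.

Lemma am_gm_kernel (K : \bar R) (t a b : R) : 0 <= K -> (0 < t)%R ->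
  `|K * (a * b)%:E| <=
  (t / 2)%:E * (K * (a ^+ 2)%:E) + (t^-1 / 2)%:E * (K * (b ^+ 2)%:E).
Proof.
move=> K0 t0; rewrite abseM (gee0_abs K0) abse_EFin.
rewrite !(muleCA _ K) -ge0_muleDr//; first last.
- by rewrite mule_ge0// lee_fin ?sqr_ge0// divr_ge0// invr_ge0 ltW.
- by rewrite mule_ge0// lee_fin ?sqr_ge0// divr_ge0// ltW.
by rewrite lee_wpmul2l// -!EFinM -EFinD lee_fin am_gm_real.
Qed.

(** For [K] finite and positive and [A] finite, this is [am_gm_real] applied to [a sqrt(K)] and
    [A b / sqrt(K)]. In the degenerate cases with [a] and [b] nonzero, either [K] or the quotient is
    infinite and so is the right side, or [K = A = 0] and the left side vanishes. *)
Lemma am_gm_quotient (A K : \bar R) (t a b : R) : 0 <= K -> (0 < t)%R ->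
  `|A * (a * b)%:E| <=
  (t / 2)%:E * (K * (a ^+ 2)%:E) + (t^-1 / 2)%:E * (A ^+ 2 * K^-1 * (b ^+ 2)%:E).
Proof.
move=> K0 t0.
have tV0 : (0 < t^-1)%R by rewrite invr_gt0.
have A20 : 0 <= A ^+ 2 by rewrite expe2 sqre_ge0.
have AK0 : 0 <= A ^+ 2 * K^-1 by rewrite mule_ge0// inve_ge0.
have l0 : 0 <= (t / 2)%:E * (K * (a ^+ 2)%:E).
  by rewrite mule_ge0 ?lee_fin ?divr_ge0 ?(ltW t0)// mule_ge0// lee_fin sqr_ge0.
have r0 : 0 <= (t^-1 / 2)%:E * (A ^+ 2 * K^-1 * (b ^+ 2)%:E).
  by rewrite mule_ge0 ?lee_fin ?divr_ge0 ?(ltW tV0)// mule_ge0// lee_fin sqr_ge0.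
have [a0|a0] := eqVneq a 0%R; first by rewrite {1}a0 mul0r mule0 abse0 adde_ge0.
have [b0|b0] := eqVneq b 0%R; first by rewrite {1}b0 mulr0 mule0 abse0 adde_ge0.
have a2 : (0 < a ^+ 2)%R by rewrite exprn_even_gt0.
have b2 : (0 < b ^+ 2)%R by rewrite exprn_even_gt0.
have th : (0 < t / 2)%R by rewrite divr_gt0.
have tVh : (0 < t^-1 / 2)%R by rewrite divr_gt0.
have [Ky|Ky] := eqVneq K +oo.
  rewrite {1}Ky gt0_mulye ?lte_fin// gt0_muley ?lte_fin// addye ?leey//.
  by rewrite gt_eqF// (lt_le_trans _ r0)// ltNye.
have [AKy|AKy] := eqVneq (A ^+ 2 * K^-1) +oo.
  rewrite AKy gt0_mulye ?lte_fin// gt0_muley ?lte_fin// addey ?leey//.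
  by rewrite gt_eqF// (lt_le_trans _ l0)// ltNye.
case: K K0 Ky AKy AK0 l0 r0 => [c| |]// c0 _ AKy AK0 _ _.
(* With [K] finite, an infinite [A] makes the quotient infinite, a case already settled. *)
case: A A20 AKy AK0 => [r| |]; first last.
- rewrite inver; case: ifPn => [|c1]; first by rewrite expe2 mulNyNy mulyy eqxx.
  rewrite expe2 mulNyNy gt0_mulye ?eqxx// lte_fin invr_gt0.
  by rewrite lt_neqAle eq_sym c1 -lee_fin.
- rewrite inver; case: ifPn => [|c1]; first by rewrite expe2 !mulyy eqxx.
  rewrite expe2 mulyy gt0_mulye ?eqxx// lte_fin invr_gt0.
  by rewrite lt_neqAle eq_sym c1 -lee_fin.
move=> _; rewrite inver; case: ifPn => [/eqP ->|c1 _ _].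
  have [->|rn0] := eqVneq r 0%R; first last.
    by rewrite -EFin_expe gt0_muley ?eqxx// lte_fin exprn_even_gt0.
  by rewrite !mul0e abse0 => _ _; rewrite expe2 !mul0e !mule0 adde0.
have c2 : (0 < c)%R by rewrite lt_neqAle eq_sym c1 -lee_fin.
rewrite -EFin_expe -!EFinM abse_EFin -EFinD lee_fin.
have -> : (r * (a * b) = (a * Num.sqrt c) * (r * b / Num.sqrt c))%R.
  by field; rewrite sqrtr_eq0 -ltNge.
apply: (le_trans (am_gm_real _ _ _ t0)); rewrite !exprMn exprVn sqr_sqrtr ?(ltW c2)//.
by rewrite le_eqVlt; apply/orP; left; apply/eqP; congr (_ * _ + _ * _)%R; ring.
Qed.

End weighted_am_gm.

(** * Symmetric and antisymmetric parts of the kernel *)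

Section kernels.
Context {R : realType} {d : nat}.
Local Notation Rd := 'rV[R]_d.
Local Notation vfield := (Rd -> Rd).
Variable k : Rd * Rd -> \bar R.
Hypothesis k_ge0 : forall z, (0 <= k z)%E.
Local Open Scope ereal_scope.

Lemma ksym_ge0 z : 0 <= ksym k z.
Proof. by rewrite mule_ge0 ?adde_ge0// lee_fin. Qed.

Lemma ksym_swap z : ksym k (z.2, z.1) = ksym k z.
Proof. by rewrite /ksym /= addeC; case: z. Qed.

Lemma ksym_lty_fin z : ksym k z < +oo ->
  k z \is a fin_num /\ k (z.2, z.1) \is a fin_num.
Proof.
move=> h; have kfin z' : k z' != +oo -> k z' \is a fin_num.
  by rewrite ge0_fin_numE// ltey.
have kN z' : k z' != -oo by rewrite gt_eqF// (lt_le_trans _ (k_ge0 z'))// ltNye.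
have [kz|kz] := eqVneq (k z) +oo.
  by move: h; rewrite /ksym kz addye// gt0_muley ?lte_fin ?invr_gt0.
have [kz'|kz'] := eqVneq (k (z.2, z.1)) +oo.
  by move: h; rewrite /ksym kz' addey// gt0_muley ?lte_fin ?invr_gt0.
by split; exact: kfin.
Qed.

(** A finite [ksym] forces both values of [k] to be finite, since they are nonnegative; then [fine]
    loses nothing and the default branch of [kanti] agrees with the true difference. *)
Lemma kernel_decomp z : ksym k z < +oo ->
  [/\ fine (k z) = (fine (ksym k z) + fine (kanti k z))%R,
      ksym k z \is a fin_num & kanti k z \is a fin_num].
Proof.
move=> /ksym_lty_fin[]; rewrite /ksym /kanti.
case: (k z) (k (z.2, z.1)) => [r| |] [s| |]// _ _; split => //=.
- by case: ifPn => [/eqP[->]|_] /=; field.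
- by case: ifPn.
Qed.

Lemma k_le_ksym z : k z <= 2%:E * ksym k z.
Proof.
by rewrite /ksym muleA -EFinM mulfV// mul1e leeDl.
Qed.

End kernels.

(** * The energy space *)

Section swap_integral.
Context {R : realType} {d : nat}.
Local Notation Rd := 'rV[R]_d.
Local Notation leb := (@lebesgue_rV R d).
Local Notation leb2 := (@lebesgue_rV R d \x @lebesgue_rV R d)%E.
Local Open Scope ereal_scope.

(** Tonelli in both orders: exchanging the variables of [f] exchanges the order of integration. *)
Lemma ge0_integral_swap (f : Rd * Rd -> \bar R) :
  measurable_fun [set: Rd * Rd] f -> (forall z, 0 <= f z) ->
  \int[leb2]_z f (z.2, z.1) = \int[leb2]_z f z.
Proof.
move=> mf f0; rewrite (@fubini_tonelli2 _ _ _ _ _ leb leb f)// fubini_tonelli1//.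
exact: measurable_swapped.
Qed.

Lemma integrable_swap (f : Rd * Rd -> \bar R) : leb2.-integrable setT f ->
  leb2.-integrable setT (fun z => f (z.2, z.1)).
Proof.
move=> /integrableP[mf fi]; apply/integrableP; split.
  exact: measurable_swapped.
rewrite (ge0_integral_swap (fun z => `|f z|))//.
exact: measurableT_comp.
Qed.

Lemma integral_swap (f : Rd * Rd -> \bar R) : leb2.-integrable setT f ->
  \int[leb2]_z f (z.2, z.1) = \int[leb2]_z f z.
Proof.
move=> fi; rewrite -(integral21_prod_meas1 fi) -integral12_prod_meas1//.
exact: integrable_swap.
Qed.

End swap_integral.

Section Sspace_theory.
Context {R : realType} {d : nat}.
Local Notation Rd := 'rV[R]_d.
Local Notation vfield := (Rd -> Rd).
Local Notation leb := (@lebesgue_rV R d).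
Local Notation leb2 := (@lebesgue_rV R d \x @lebesgue_rV R d)%E.
Variable k : Rd * Rd -> \bar R.
Hypothesis mk : measurable_fun [set: Rd * Rd] k.
Hypothesis k_ge0 : forall z, (0 <= k z)%E.
Local Open Scope ereal_scope.
Implicit Types u v : vfield.

Let ks0 := ksym_ge0 k k_ge0.
Let mks := measurable_ksym k mk.

Lemma measurable_enorm_sqr v : measurable_fun setT v ->
  measurable_fun setT (fun x => (enorm (v x) ^+ 2)%:E).
Proof.
by move=> mv; apply/measurable_EFinP/measurable_funX; exact: measurable_enorm.
Qed.

Lemma measurable_ksym_Dop v : measurable_fun setT v ->
  measurable_fun setT (fun z => ksym k z * (Dop v z ^+ 2)%:E).
Proof.
move=> mv; apply: emeasurable_funM => //; apply/measurable_EFinP/measurable_funX.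
exact: measurable_Dop.
Qed.

Lemma ksym_Dop_ge0 v z : 0 <= ksym k z * (Dop v z ^+ 2)%:E.
Proof. by rewrite mule_ge0// lee_fin sqr_ge0. Qed.

(** Squaring [sqrte (ksym k z)] gives back [ksym k z] even at +oo, so the two L2 conditions become
    the finiteness of the two terms of [Ssqnorm]. *)
Lemma SspaceP v : Sspace k v <-> [/\ measurable_fun setT v,
  \int[leb]_x (enorm (v x) ^+ 2)%:E < +oo &
  \int[leb2]_z (ksym k z * (Dop v z ^+ 2)%:E) < +oo].
Proof.
have E1 : (fun x => (enorm (v x))%:E ^+ 2) = fun x => (enorm (v x) ^+ 2)%:E.
  by apply/funext => x; rewrite EFin_expe.
have E2 : (fun z => ((Dop v z)%:E * sqrte (ksym k z)) ^+ 2) =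
    fun z => ksym k z * (Dop v z ^+ 2)%:E.
  apply/funext => z; rewrite muleC [in LHS]expe2 muleACA -[sqrte _ * _]expe2.
  by rewrite sqr_sqrte// -EFinM -expr2.
split=> [[mv [_ +] [_ +]]|[mv i1 i2]]; rewrite ?E1 ?E2//.
split => //; split; rewrite ?E1 ?E2//.
  by apply/measurable_EFinP; exact: measurable_enorm.
apply: emeasurable_funM; first by apply/measurable_EFinP; exact: measurable_Dop.
exact: measurable_sqrte.
Qed.

Lemma Ssqnorm_ge0 v : 0 <= Ssqnorm k v.
Proof.
apply: adde_ge0; apply: integral_ge0 => z _; last exact: ksym_Dop_ge0.
by rewrite lee_fin sqr_ge0.
Qed.

(** [Snorm] passes through [fine], which sends +oo to 0; membership in S keeps the squared norm
    finite. *)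
Lemma Snorm_sqr v : Sspace k v -> (Snorm k v ^+ 2)%:E = Ssqnorm k v.
Proof.
move=> /SspaceP[_ i1 i2]; rewrite /Snorm sqr_sqrtr ?fine_ge0 ?Ssqnorm_ge0//.
by rewrite fineK// ge0_fin_numE ?Ssqnorm_ge0// lte_add_pinfty.
Qed.

(** Both terms of the norm obey [|a - b|^2 <= 2 (|a|^2 + |b|^2)]. Continuity at a pair [u0], [v0]
    evaluates the form on such differences. *)
Lemma Sspace_sub u v : Sspace k u -> Sspace k v -> Sspace k (u \- v)%R.
Proof.
move=> /SspaceP[mu iu1 iu2] /SspaceP[mv iv1 iv2].
apply/SspaceP; split; first exact: measurable_rVB.
- apply: (@le_lt_trans _ _ (\int[leb]_x
      (2%:E * ((enorm (u x) ^+ 2)%:E + (enorm (v x) ^+ 2)%:E)))).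
    apply: ge0_le_integral => //.
    + by move=> x _; rewrite lee_fin sqr_ge0.
    + by apply: measurable_enorm_sqr; exact: measurable_rVB.
    + by apply: measurable_funeM; apply: emeasurable_funD; exact: measurable_enorm_sqr.
    + move=> x _; rewrite -EFinD -EFinM lee_fin.
      by have := enormD_sqr (u x) (- v x); rewrite enormN.
  rewrite ge0_integralZl//; first last.
  + by move=> x _; rewrite adde_ge0// lee_fin sqr_ge0.
  + by apply: emeasurable_funD; exact: measurable_enorm_sqr.
  rewrite ge0_integralD//.
  + by rewrite lte_mul_pinfty// lte_add_pinfty.
  + by move=> x _; rewrite lee_fin sqr_ge0.
  + exact: measurable_enorm_sqr.
  + by move=> x _; rewrite lee_fin sqr_ge0.
  + exact: measurable_enorm_sqr.
- apply: (@le_lt_trans _ _ (\int[leb2]_z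
      (2%:E * (ksym k z * (Dop u z ^+ 2)%:E + ksym k z * (Dop v z ^+ 2)%:E)))).
    apply: ge0_le_integral => //.
    + by move=> z _; exact: ksym_Dop_ge0.
    + by apply: measurable_ksym_Dop; exact: measurable_rVB.
    + by apply: measurable_funeM; apply: emeasurable_funD; exact: measurable_ksym_Dop.
    + move=> z _; rewrite -ge0_muleDr ?lee_fin ?sqr_ge0// muleCA lee_wpmul2l//.
      rewrite -EFinD -EFinM lee_fin Dop_sub -subr_ge0.
      by rewrite (_ : (_ - _)%R = (Dop u z + Dop v z) ^+ 2)%R ?sqr_ge0//; ring.
  rewrite ge0_integralZl//; first last.
  + by move=> z _; rewrite adde_ge0// ksym_Dop_ge0.
  + by apply: emeasurable_funD; exact: measurable_ksym_Dop.
  rewrite ge0_integralD//.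
  + by rewrite lte_mul_pinfty// lte_add_pinfty.
  + by move=> z _; exact: ksym_Dop_ge0.
  + exact: measurable_ksym_Dop.
  + by move=> z _; exact: ksym_Dop_ge0.
  + exact: measurable_ksym_Dop.
Qed.

(** The integrable function k_s D(u)^2 is finite almost everywhere, and where k_s is infinite this
    forces the other factor to vanish. *)
Lemma ae_ksym_Dop u : Sspace k u ->
  {ae leb2, forall z, ksym k z < +oo \/ Dop u z = 0%R}.
Proof.
move=> /SspaceP[mu _ iu].
have /integrable_ae : leb2.-integrable setT (fun z => ksym k z * (Dop u z ^+ 2)%:E).
  apply/integrableP; split; first exact: measurable_ksym_Dop.
  by under eq_integral do rewrite gee0_abs ?ksym_Dop_ge0//.
move=> /(_ measurableT); apply: filterS => z /(_ I).
have [->|Du0 fz] := eqVneq (Dop u z) 0%R; first by right.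
left; rewrite ltey; apply/eqP => kz; move: fz; rewrite kz gt0_mulye//.
by rewrite lte_fin exprn_even_gt0.
Qed.

Lemma measurable_Fsym_integrand u v : measurable_fun setT u ->
  measurable_fun setT v -> measurable_fun setT (Fsym_integrand k u v).
Proof.
move=> mu mv; apply: emeasurable_funM => //; apply/measurable_EFinP.
by apply: measurable_funM; exact: measurable_Dop.
Qed.

Lemma measurable_Fanti_integrand u v : measurable_fun setT u ->
  measurable_fun setT v -> measurable_fun setT (Fanti_integrand k u v).
Proof.
move=> mu mv; apply: emeasurable_funM; first exact: measurable_kanti.
apply/measurable_EFinP.
by apply: measurable_funM; [exact: measurable_Dop|exact: measurable_dotp_dir].
Qed.

Lemma measurable_Fn_integrand u v : measurable_fun setT u ->
  measurable_fun setT v -> measurable_fun setT (Fn_integrand k u v).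
Proof.
move=> mu mv; apply: emeasurable_funM => //; apply/measurable_EFinP.
by apply: measurable_funM; [exact: measurable_Dop|exact: measurable_dotp_dir].
Qed.

Lemma integral_Fsym_le u v (t : R) : Sspace k u -> Sspace k v -> (0 < t)%R ->
  \int[leb2]_z `|Fsym_integrand k u v z| <=
  (t / 2)%:E * Ssqnorm k u + (t^-1 / 2)%:E * Ssqnorm k v.
Proof.
move=> /SspaceP[mu _ _] /SspaceP[mv _ _] t0.
have h1 : (0 <= t / 2)%R by rewrite divr_ge0// ltW.
have h2 : (0 <= t^-1 / 2)%R by rewrite divr_ge0// invr_ge0 ltW.
apply: (@le_trans _ _ (\int[leb2]_z
   ((t / 2)%:E * (ksym k z * (Dop u z ^+ 2)%:E) +
    (t^-1 / 2)%:E * (ksym k z * (Dop v z ^+ 2)%:E)))).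
  apply: ge0_le_integral => //.
  - by apply: measurableT_comp => //; exact: measurable_Fsym_integrand.
  - by apply: emeasurable_funD; apply: measurable_funeM; exact: measurable_ksym_Dop.
  - by move=> z _; exact: am_gm_kernel.
rewrite ge0_integralD//; first last.
- by apply: measurable_funeM; exact: measurable_ksym_Dop.
- by move=> z _; rewrite mule_ge0 ?lee_fin// ksym_Dop_ge0.
- by apply: measurable_funeM; exact: measurable_ksym_Dop.
- by move=> z _; rewrite mule_ge0 ?lee_fin// ksym_Dop_ge0.
have L0 w : 0 <= \int[leb]_x (enorm (w x) ^+ 2)%:E.
  by apply: integral_ge0 => x _; rewrite lee_fin sqr_ge0.
rewrite !ge0_integralZl//; first last.
- by move=> z _; exact: ksym_Dop_ge0.
- exact: measurable_ksym_Dop.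
- by move=> z _; exact: ksym_Dop_ge0.
- exact: measurable_ksym_Dop.
by rewrite leeD// lee_wpmul2l ?lee_fin// leeDr.
Qed.

Variables (kt : Rd * Rd -> \bar R) (A1 A2 : R).
Hypothesis mkt : measurable_fun [set: Rd * Rd] kt.
Hypothesis kt_ge0 : forall z, 0 <= kt z.
Hypothesis kK : condK k kt A1 A2.

Let q z := kanti k z ^+ 2 * (kt z)^-1.

Let q0 z : 0 <= q z.
Proof. by rewrite mule_ge0 ?inve_ge0// expe2 sqre_ge0. Qed.

Let mq : measurable_fun setT q.
Proof.
apply: emeasurable_funM; last exact: (measurableT_comp measurable_inve).
under eq_fun do rewrite expe2.
by apply: emeasurable_funM; exact: measurable_kanti.
Qed.

(** After [|v(x) . dir| <= |v(x)|], the factor [|v(x)|^2] no longer depends on y. With y as the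
    inner variable it leaves the integral, and (K2) bounds what remains by [A2] for every x. *)
Lemma integral_quotient_le v : measurable_fun setT v ->
  \int[leb2]_z (q z * (dotp (v z.1) (dir z) ^+ 2)%:E) <=
  A2%:E * \int[leb]_x (enorm (v x) ^+ 2)%:E.
Proof.
move=> mv.
have mv1 : measurable_fun setT (fun z : Rd * Rd => (enorm (v z.1) ^+ 2)%:E).
  by apply: (measurableT_comp (measurable_enorm_sqr v mv)).
apply: (@le_trans _ _ (\int[leb2]_z (q z * (enorm (v z.1) ^+ 2)%:E))).
  apply: ge0_le_integral => //.
  - by move=> z _; rewrite mule_ge0// lee_fin sqr_ge0.
  - apply: emeasurable_funM => //; apply/measurable_EFinP/measurable_funX.
    exact: measurable_dotp_dir.
  - exact: emeasurable_funM.
  - by move=> z _; rewrite lee_wpmul2l// lee_fin dotp_dir_sqr_le.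
rewrite (@fubini_tonelli1 _ _ _ _ _ leb leb)//; first last.
- by move=> z; rewrite mule_ge0// lee_fin sqr_ge0.
- exact: emeasurable_funM.
have [_ _ supA2] := kK.
have Q2 x : \int[leb]_y q (x, y) <= A2%:E.
  by apply: (le_trans _ supA2); apply: ereal_sup_ubound; exists x.
have A20 : 0 <= A2%:E.
  by apply: (le_trans _ (Q2 0%R)); apply: integral_ge0.
rewrite -ge0_integralZl//; first last.
- by move=> x _; rewrite lee_fin sqr_ge0.
- exact: measurable_enorm_sqr.
have mq1 x : measurable_fun setT (fun y => q (x, y)).
  by apply: measurableT_comp => //; exact: pair1_measurable.
apply: ge0_le_integral => //.
- by move=> x _; apply: integral_ge0 => y _; rewrite mule_ge0// lee_fin sqr_ge0.
- apply: measurable_fun_fubini_tonelli_F => //; first exact: emeasurable_funM.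
  by move=> z; rewrite mule_ge0// lee_fin sqr_ge0.
- by apply: measurable_funeM; exact: measurable_enorm_sqr.
- move=> x _; rewrite /fubini_F /= ge0_integralZr// ?lee_fin ?sqr_ge0//.
  by rewrite lee_wpmul2r// lee_fin sqr_ge0.
Qed.

(** The arguments play different roles: [u] is measured by its k~-energy through (K1), [v] only by
    its L2 norm through (K2). The energy of [v] is added at the end to reach [Ssqnorm]. *)
Lemma integral_Fanti_le u v (t : R) : Sspace k u -> Sspace k v -> (0 < t)%R ->
  0 <= A1%:E -> 0 <= A2%:E ->
  \int[leb2]_z `|Fanti_integrand k u v z| <=
  (t / 2)%:E * (A1%:E * Ssqnorm k u) + (t^-1 / 2)%:E * (A2%:E * Ssqnorm k v).
Proof.
move=> Su Sv t0 A10 A20.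
move: (Su) (Sv) => /SspaceP[mu _ _] /SspaceP[mv _ _].
have h1 : (0 <= t / 2)%R by rewrite divr_ge0// ltW.
have h2 : (0 <= t^-1 / 2)%R by rewrite divr_ge0// invr_ge0 ltW.
have m1 : measurable_fun setT (fun z => kt z * (Dop u z ^+ 2)%:E).
  apply: emeasurable_funM => //; apply/measurable_EFinP/measurable_funX.
  exact: measurable_Dop.
have m2 : measurable_fun setT (fun z => q z * (dotp (v z.1) (dir z) ^+ 2)%:E).
  apply: emeasurable_funM => //; apply/measurable_EFinP/measurable_funX.
  exact: measurable_dotp_dir.
have p1 z : 0 <= kt z * (Dop u z ^+ 2)%:E by rewrite mule_ge0// lee_fin sqr_ge0.
have p2 z : 0 <= q z * (dotp (v z.1) (dir z) ^+ 2)%:E.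
  by rewrite mule_ge0// lee_fin sqr_ge0.
apply: (@le_trans _ _ (\int[leb2]_z
   ((t / 2)%:E * (kt z * (Dop u z ^+ 2)%:E) +
    (t^-1 / 2)%:E * (q z * (dotp (v z.1) (dir z) ^+ 2)%:E)))).
  apply: ge0_le_integral => //.
  - by apply: measurableT_comp => //; exact: measurable_Fanti_integrand.
  - by apply: emeasurable_funD; exact: measurable_funeM.
  - by move=> z _; exact: am_gm_quotient.
have [_ K1 _] := kK.
rewrite ge0_integralD//; first last.
- exact: measurable_funeM.
- by move=> z _; rewrite mule_ge0 ?lee_fin.
- exact: measurable_funeM.
- by move=> z _; rewrite mule_ge0 ?lee_fin.
rewrite !ge0_integralZl// leeD// lee_wpmul2l ?lee_fin//; first exact: K1.
apply: (le_trans (integral_quotient_le v mv)); rewrite lee_wpmul2l// leeDl//.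
by apply: integral_ge0 => z _; exact: ksym_Dop_ge0.
Qed.

End Sspace_theory.

(** * The bilinear form *)

Section bilinear_form.
Context {R : realType} {d : nat}.
Local Notation Rd := 'rV[R]_d.
Local Notation vfield := (Rd -> Rd).
Local Notation leb := (@lebesgue_rV R d).
Local Notation leb2 := (@lebesgue_rV R d \x @lebesgue_rV R d)%E.
Variable k : Rd * Rd -> \bar R.
Hypothesis mk : measurable_fun [set: Rd * Rd] k.
Hypothesis k_ge0 : forall z, (0 <= k z)%E.
Implicit Types u v w : vfield.

Let mks := measurable_ksym k mk.
Let mka := measurable_kanti k mk.

(** Real-valued versions of the integrands, on which subtraction is legitimate. [fine] sends
    infinite kernel values to 0; for [u] in S this alters the integrands on a null set only. *)
Definition Fsym_real u v z : R := fine (ksym k z) * (Dop u z * Dop v z).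

Definition Fanti_real u v z : R :=
  fine (kanti k z) * (Dop u z * dotp (v z.1) (dir z)).

Lemma measurable_fine_comp dT (T : measurableType dT) (f : T -> \bar R) :
  measurable_fun [set: T] f -> measurable_fun [set: T] (fine \o f).
Proof. by move=> mf; apply: measurableT_comp => //; exact: fine_measurable. Qed.

Lemma measurable_Fsym_real u v : measurable_fun setT u -> measurable_fun setT v ->
  measurable_fun setT (Fsym_real u v).
Proof.
move=> mu mv; apply: measurable_funM; first exact: (measurable_fine_comp _ _ _ mks).
by apply: measurable_funM; exact: measurable_Dop.
Qed.

Lemma measurable_Fanti_real u v : measurable_fun setT u -> measurable_fun setT v ->
  measurable_fun setT (Fanti_real u v).
Proof.
move=> mu mv; apply: measurable_funM; first exact: (measurable_fine_comp _ _ _ mka).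
by apply: measurable_funM; [exact: measurable_Dop|exact: measurable_dotp_dir].
Qed.

Lemma abse_fine_le (x : \bar R) : (`|(fine x)%:E| <= `|x|)%E.
Proof. by case: x => [r| |] //=; rewrite normr0 leey. Qed.

Section defined.
Variables u v : vfield.
Hypotheses (Su : Sspace k u) (Sv : Sspace k v) (uvF : Fform_defined k u v).

Let mu : measurable_fun setT u. Proof. by case: Su. Qed.
Let mv : measurable_fun setT v. Proof. by case: Sv. Qed.

Lemma integrable_Fsym_real : leb2.-integrable setT (EFin \o Fsym_real u v).
Proof.
have [Fs _] := uvF.
apply: le_integrable Fs => //.
  by apply/measurable_EFinP; exact: (measurable_Fsym_real _ _ mu mv).
move=> z _; rewrite /comp /Fsym_real /Fsym_integrand (EFinM (fine _)).
by rewrite 2!abseM lee_wpmul2r// abse_fine_le.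
Qed.

Lemma integrable_Fanti_real : leb2.-integrable setT (EFin \o Fanti_real u v).
Proof.
have [_ Fa] := uvF.
apply: le_integrable Fa => //.
  by apply/measurable_EFinP; exact: (measurable_Fanti_real _ _ mu mv).
move=> z _; rewrite /comp /Fanti_real /Fanti_integrand (EFinM (fine _)).
by rewrite 2!abseM lee_wpmul2r// abse_fine_le.
Qed.

(** By [ae_ksym_Dop], at almost every point either both kernels are finite or D(u) = 0, and in
    either case the extended and real integrands agree. *)
Lemma FformE : Fform k u v =
  2^-1 * (\int[leb2]_z Fsym_real u v z) + \int[leb2]_z Fanti_real u v z.
Proof.
have ae := ae_ksym_Dop k mk k_ge0 u Su.
rewrite /Fform; congr (_ * fine _ + fine _); apply: ae_eq_integral => //.
- exact: measurable_Fsym_integrand.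
- by apply/measurable_EFinP; exact: (measurable_Fsym_real _ _ mu mv).
- apply: filterS ae => z [h _|Du _]; last first.
    by rewrite /Fsym_integrand /Fsym_real Du !mul0r mulr0 mule0.
  have [_ fs _] := kernel_decomp k k_ge0 z h.
  by rewrite /Fsym_integrand /Fsym_real [in RHS]EFinM fineK.
- exact: measurable_Fanti_integrand.
- by apply/measurable_EFinP; exact: (measurable_Fanti_real _ _ mu mv).
- apply: filterS ae => z [h _|Du _]; last first.
    by rewrite /Fanti_integrand /Fanti_real Du !mul0r mulr0 mule0.
  have [_ _ fa] := kernel_decomp k k_ge0 z h.
  by rewrite /Fanti_integrand /Fanti_real [in RHS]EFinM fineK.
Qed.

End defined.

Hypothesis F_defined : forall u v, Sspace k u -> Sspace k v -> Fform_defined k u v.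

Lemma Fform_subl u v w : Sspace k u -> Sspace k v -> Sspace k w ->
  Fform k (u \- v) w = Fform k u w - Fform k v w.
Proof.
move=> Su Sv Sw; have Suv := Sspace_sub k mk k_ge0 u v Su Sv.
have Fu := F_defined u w Su Sw; have Fv := F_defined v w Sv Sw.
have Fuv := F_defined (u \- v) w Suv Sw.
rewrite !FformE//.
have -> : \int[leb2]_z Fsym_real (u \- v) w z =
    \int[leb2]_z (Fsym_real u w z - Fsym_real v w z).
  by apply: eq_Rintegral => z _; rewrite /Fsym_real Dop_sub; ring.
have -> : \int[leb2]_z Fanti_real (u \- v) w z =
    \int[leb2]_z (Fanti_real u w z - Fanti_real v w z).
  by apply: eq_Rintegral => z _; rewrite /Fanti_real Dop_sub; ring.
rewrite !RintegralB//.
- by ring.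
- exact: integrable_Fanti_real.
- exact: integrable_Fanti_real.
- exact: integrable_Fsym_real.
- exact: integrable_Fsym_real.
Qed.

Lemma Fform_subr u v w : Sspace k u -> Sspace k v -> Sspace k w ->
  Fform k w (u \- v) = Fform k w u - Fform k w v.
Proof.
move=> Su Sv Sw; have Suv := Sspace_sub k mk k_ge0 u v Su Sv.
have Fu := F_defined w u Sw Su; have Fv := F_defined w v Sw Sv.
have Fuv := F_defined w (u \- v) Sw Suv.
rewrite !FformE//.
have -> : \int[leb2]_z Fsym_real w (u \- v) z =
    \int[leb2]_z (Fsym_real w u z - Fsym_real w v z).
  by apply: eq_Rintegral => z _; rewrite /Fsym_real Dop_sub; ring.
have -> : \int[leb2]_z Fanti_real w (u \- v) z =
    \int[leb2]_z (Fanti_real w u z - Fanti_real w v z).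
  by apply: eq_Rintegral => z _; rewrite /Fanti_real dotpBl; ring.
rewrite !RintegralB//.
- by ring.
- exact: integrable_Fanti_real.
- exact: integrable_Fanti_real.
- exact: integrable_Fsym_real.
- exact: integrable_Fsym_real.
Qed.

Lemma abs_fine_integral_le dT (T : measurableType dT) (mu : {measure set T -> \bar R})
    (f : T -> \bar R) (b : R) : measurable_fun [set: T] f ->
  (\int[mu]_x `|f x| <= b%:E)%E -> `|fine (\int[mu]_x f x)| <= b.
Proof.
move=> mf fb; rewrite -lee_fin (le_trans _ fb)//.
rewrite (le_trans _ (le_abse_integral mu measurableT mf))//.
exact: abse_fine_le.
Qed.

End bilinear_form.

(** * Continuity of a bilinear form from a weighted bound *)

Section bounded_bilinear.
Context {R : realType} {T : Type} {V : zmodType}.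
Implicit Types u v w : T -> V.

(* The weight t = 1/delta makes a factor of size delta small against a fixed
   one. *)
Lemma bounded_form_continuous (S X : set (T -> V)) (N : (T -> V) -> R)
    (F : (T -> V) -> (T -> V) -> R) (C : R) :
  X `<=` S -> (forall u v, S u -> S v -> S (u \- v)) -> (forall u, 0 <= N u) ->
  (forall u v w, S u -> S v -> S w -> F (u \- v) w = F u w - F v w) ->
  (forall u v w, S u -> S v -> S w -> F w (u \- v) = F w u - F w v) ->
  0 <= C ->
  (forall u v t, S u -> S v -> 0 < t ->
    `|F u v| <= C * (t * N u ^+ 2 + t^-1 * N v ^+ 2)) ->
  form_continuous X N F.
Proof.
move=> XS SB N0 Fl Fr C0 FC u0 v0 Xu0 Xv0 e e0.
have Su0 := XS _ Xu0; have Sv0 := XS _ Xv0.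
have U0 : 0 <= N u0 ^+ 2 by rewrite sqr_ge0.
have V0 : 0 <= N v0 ^+ 2 by rewrite sqr_ge0.
(* The three terms of the telescoped difference cost [C delta] times 2, [1 + N v0 ^+ 2] and
   [N u0 ^+ 2 + 1], which add up to the second factor. [C + 1] instead of [C] makes [B] positive. *)
pose B := (C + 1) * (4 + N u0 ^+ 2 + N v0 ^+ 2).
have B0 : 0 < B.
  by apply: mulr_gt0; [rewrite ltr_wpDl|rewrite ltr_wpDr// ltr_wpDr].
(* The bound by 1 gives [delta ^ 2 <= delta]; the other one leaves a total of at most [e / 2]. *)
pose delta := Num.min 1 (e / (2 * B)).
have delta0 : 0 < delta by rewrite lt_min ltr01 divr_gt0// mulr_gt0.
have delta1 : delta <= 1 by rewrite ge_min lexx.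
have deltaB : B * delta <= e / 2.
  rewrite mulrC -ler_pdivlMr// -mulrA -invfM.
  by rewrite ge_min lexx orbT.
exists delta => // u v Xu Xv Nu Nv.
have Su := XS _ Xu; have Sv := XS _ Xv.
have Sa := SB u u0 Su Su0; have Sb := SB v v0 Sv Sv0.
have -> : F u v - F u0 v0 =
    F (u \- u0) (v \- v0) + F (u \- u0) v0 + F u0 (v \- v0).
  by rewrite !(Fl, Fr)//; ring.
have sq w : N w < delta -> N w ^+ 2 <= delta * delta.
  by move=> h; rewrite expr2 ler_pM// ltW.
have dd : delta * delta <= delta by rewrite ler_piMr// ltW.
have b1 : `|F (u \- u0) (v \- v0)| <= C * (delta + delta).
  apply: (le_trans (FC _ _ 1 Sa Sb ltr01)); rewrite invr1 !mul1r ler_wpM2l//.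
  by rewrite lerD// (le_trans (sq _ _) dd).
have dV : delta^-1 * (delta * delta) = delta by rewrite mulKf// gt_eqF.
have dV0 : 0 < delta^-1 by rewrite invr_gt0.
have b2 : `|F (u \- u0) v0| <= C * (delta + delta * N v0 ^+ 2).
  apply: (le_trans (FC _ _ _ Sa Sv0 dV0)); rewrite invrK ler_wpM2l// lerD2r.
  by rewrite -[leRHS]dV ler_pM2l// sq.
(* Here the small argument is the second one, so the weight is [delta] itself. *)
have b3 : `|F u0 (v \- v0)| <= C * (delta * N u0 ^+ 2 + delta).
  apply: (le_trans (FC _ _ _ Su0 Sb delta0)); rewrite ler_wpM2l// lerD2l.
  by rewrite -[leRHS]dV ler_pM2l// sq.
apply: (@le_lt_trans _ _ (B * delta)); last first.
  by rewrite (le_lt_trans deltaB)// ltr_pdivrMr// ltr_pMr// ltrDl.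
rewrite (le_trans (ler_normD _ _))// (le_trans (lerD (ler_normD _ _) (lexx _)))//.
rewrite (le_trans (lerD (lerD b1 b2) b3))// /B -subr_ge0.
rewrite (_ : _ - _ = delta * (4 + N u0 ^+ 2 + N v0 ^+ 2)).
  by rewrite mulr_ge0 ?(ltW delta0)// !addr_ge0.
by ring.
Qed.

End bounded_bilinear.

(** * Boundedness and continuity of F on the energy space *)

Section continuity.
Context {R : realType} {d : nat}.
Local Notation Rd := 'rV[R]_d.
Local Notation vfield := (Rd -> Rd).
Local Notation leb := (@lebesgue_rV R d).
Local Notation leb2 := (@lebesgue_rV R d \x @lebesgue_rV R d)%E.
Variable k : Rd * Rd -> \bar R.
Hypothesis mk : measurable_fun [set: Rd * Rd] k.
Hypothesis k_ge0 : forall z, (0 <= k z)%E.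
Hypothesis kK12 : condK12 k.
Implicit Types u v w : vfield.

Lemma Sspace_Fform_defined u v : Sspace k u -> Sspace k v -> Fform_defined k u v.
Proof.
move=> Su Sv; have [kt [A1 [A2 [[mkt kt0 _] A11 A21 kK]]]] := kK12.
have [mu _ _] := Su; have [mv _ _] := Sv.
have A10 : (0 <= A1%:E)%E by rewrite lee_fin (le_trans _ A11).
have A20 : (0 <= A2%:E)%E by rewrite lee_fin (le_trans _ A21).
split; apply/integrableP; split.
- exact: measurable_Fsym_integrand.
- apply: (le_lt_trans (integral_Fsym_le k mk k_ge0 u v 1 Su Sv ltr01)).
  by rewrite -!Snorm_sqr// -!EFinM -EFinD ltry.
- exact: measurable_Fanti_integrand.
- apply: (le_lt_trans (integral_Fanti_le k mk k_ge0 kt A1 A2 mkt kt0 kK u v 1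
    Su Sv ltr01 A10 A20)).
  by rewrite -!Snorm_sqr// -!EFinM -EFinD ltry.
Qed.

(** The symmetric part contributes [(t U + t^-1 V) / 4] and the antisymmetric part
    [(A1 t U + A2 t^-1 V) / 2]; as [A1] and [A2] are at least 1, the constant [A1 + A2] covers
    both. *)
Lemma normr_Fform_le kt A1 A2 u v (t U V : R) : measurable_fun setT kt ->
  (forall z, 0 <= kt z)%E -> 1 <= A1 -> 1 <= A2 -> condK k kt A1 A2 ->
  Sspace k u -> Sspace k v -> Ssqnorm k u = U%:E -> Ssqnorm k v = V%:E -> 0 < t ->
  `|Fform k u v| <= (A1 + A2) * (t * U + t^-1 * V).
Proof.
move=> mkt kt0 A11 A21 kK Su Sv EU EV t0.
have A10 : (0 <= A1%:E)%E by rewrite lee_fin (le_trans _ A11).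
have A20 : (0 <= A2%:E)%E by rewrite lee_fin (le_trans _ A21).
have [mu _ _] := Su; have [mv _ _] := Sv.
have U0 : 0 <= U by rewrite -lee_fin -EU Ssqnorm_ge0.
have V0 : 0 <= V by rewrite -lee_fin -EV Ssqnorm_ge0.
have := integral_Fsym_le k mk k_ge0 u v t Su Sv t0.
have := integral_Fanti_le k mk k_ge0 kt A1 A2 mkt kt0 kK u v t Su Sv t0 A10 A20.
rewrite EU EV -!EFinM -!EFinD.
move=> /(abs_fine_integral_le _ _ _ _ _ (measurable_Fanti_integrand k mk u v mu mv)) ha.
move=> /(abs_fine_integral_le _ _ _ _ _ (measurable_Fsym_integrand k mk u v mu mv)) hs.
rewrite /Fform (le_trans (ler_normD _ _))// normrM ger0_norm ?invr_ge0//.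
have p1 : 0 <= t * U by rewrite mulr_ge0// ltW.
have p2 : 0 <= t^-1 * V by rewrite mulr_ge0// invr_ge0 ltW.
move: hs ha; set X := `|_|; set Y := `|_| => hs ha.
have q1 : t * U <= A1 * (t * U) by rewrite ler_peMl.
have q2 : t^-1 * V <= A2 * (t^-1 * V) by rewrite ler_peMl.
have q3 : 0 <= A2 * (t * U) by rewrite mulr_ge0// (le_trans _ A21).
have q4 : 0 <= A1 * (t^-1 * V) by rewrite mulr_ge0// (le_trans _ A11).
have e1 : t / 2 * (A1 * U) = 2^-1 * (A1 * (t * U)) by ring.
have e2 : t^-1 / 2 * (A2 * V) = 2^-1 * (A2 * (t^-1 * V)) by ring.
have e3 : t / 2 * U = 2^-1 * (t * U) by ring.
have e4 : t^-1 / 2 * V = 2^-1 * (t^-1 * V) by ring.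
rewrite mulrDl !mulrDr; move: hs ha; rewrite e1 e2 e3 e4.
move: p1 p2 q1 q2 q3 q4.
(* With the products turned into variables, the remaining inequality is linear. *)
move: (A1 * (t * U)) (A2 * (t^-1 * V)) (A2 * (t * U)) (A1 * (t^-1 * V)).
move: (t * U) (t^-1 * V).
by move=> *; lra.
Qed.

Lemma Fform_bound : exists2 C : R, 0 <= C & forall u v (t : R),
  Sspace k u -> Sspace k v -> 0 < t ->
  `|Fform k u v| <= C * (t * Snorm k u ^+ 2 + t^-1 * Snorm k v ^+ 2).
Proof.
have [kt [A1 [A2 [[mkt kt0 _] A11 A21 kK]]]] := kK12.
have A10 : (0 <= A1%:E)%E by rewrite lee_fin (le_trans _ A11).
have A20 : (0 <= A2%:E)%E by rewrite lee_fin (le_trans _ A21).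
exists (A1 + A2) => [|u v t Su Sv t0]; first by rewrite -lee_fin EFinD adde_ge0.
by apply: (normr_Fform_le kt) => //; rewrite Snorm_sqr.
Qed.

Lemma Fform_continuous (X : set vfield) : X `<=` Sspace k ->
  form_continuous X (Snorm k) (Fform k).
Proof.
move=> XS; have [C C0 FC] := Fform_bound.
have N0 u : 0 <= Snorm k u by exact: sqrtr_ge0.
have Fd := Sspace_Fform_defined.
exact: (bounded_form_continuous _ _ _ _ _ XS (Sspace_sub k mk k_ge0) N0
  (Fform_subl k mk k_ge0 Fd) (Fform_subr k mk k_ge0 Fd) C0 FC).
Qed.

End continuity.

(** * Test functions *)

Section smooth_lipschitz.
Context {R : realType} {d : nat}.
Local Notation Rd := 'rV[R]_d.
Implicit Types (u : Rd -> Rd) (x y e : Rd).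

Lemma coor_le_enorm x j : `|x ord0 j| <= enorm x.
Proof.
rewrite -sqrtr_sqr /enorm ler_sqrt ?dotp_ge0// /dotp (bigD1 j)//= expr2 lerDl.
by apply: sumr_ge0 => i _; rewrite -expr2 sqr_ge0.
Qed.

Lemma enorm_sqr_le x (b : R) : (forall j, `|x ord0 j| <= b) ->
  enorm x ^+ 2 <= d%:R * b ^+ 2.
Proof.
move=> xb; rewrite enorm_sqr /dotp.
apply: (@le_trans _ _ (\sum_(i < d) b ^+ 2)); last first.
  by rewrite sumr_const card_ord mulr_natl.
apply: ler_sum => i _; rewrite -expr2 -[x ord0 i ^+ 2]real_normK ?num_real//.
by rewrite lerXn2r// ?nnegrE// (le_trans _ (xb i)).
Qed.

Lemma is_derive_line u x e j (t : R) : derivable u (x + t *: e) e ->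
  is_derive t 1 (fun s : R => u (x + s *: e) ord0 j) ('D_e u (x + t *: e) ord0 j).
Proof.
move=> du; set phi := (fun s : R => _).
have h : h^-1 *: ((phi \o shift t) (h *: 1) - phi t) @[h --> 0^'] -->
    'D_e u (x + t *: e) ord0 j.
  have := cvg_comp _ _ du (@coord_continuous R 1 d ord0 j ('D_e u (x + t *: e))).
  move=> H; rewrite (_ : (fun h : R => _) = (fun M : Rd => M ord0 j) \o
    (fun h => h^-1 *: ((u \o shift (x + t *: e)) (h *: e) - u (x + t *: e))))//.
  apply/funext => h.
  rewrite /phi /= !mxE; congr (_ * (u _ _ _ - _)).
  by rewrite [h *: _]mulr1 scalerDl addrCA.
by apply: DeriveDef; [exact: cvgP h|exact: cvg_lim h].
Qed.

(** Mean value theorem along the i-th axis; the sign of [t] decides which end of the segment comes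
    first. *)
Lemma coordinate_step_le u (M : R) (i : 'I_d) :
  (forall x, derivable u x (delta_mx ord0 i)) ->
  (forall x j, `|'D_(delta_mx ord0 i) u x ord0 j| <= M) ->
  forall x (t : R) j,
  `|u (x + t *: delta_mx ord0 i) ord0 j - u x ord0 j| <= M * `|t|.
Proof.
move=> du DM x t j; set e : Rd := delta_mx ord0 i.
pose phi (s : R) := u (x + s *: e) ord0 j.
pose dphi (s : R) := 'D_e u (x + s *: e) ord0 j.
have dP (s : R) : is_derive s 1 phi (dphi s) by exact: is_derive_line.
have cphi a b : {within `[a, b], continuous phi}.
  by apply: derivable_within_continuous => s _; exact: ex_derive.
have -> : u x ord0 j = phi 0 by rewrite /phi scale0r addr0.
rewrite -/(phi t).
have [t0|/ltW t0] := leP 0 t.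
  have [c _ ->] := MVT_segment t0 (fun s _ => dP s) (cphi 0 t).
  by rewrite subr0 normrM ler_wpM2r// DM.
have [c _] := MVT_segment t0 (fun s _ => dP s) (cphi t 0).
by rewrite distrC => ->; rewrite sub0r normrM normrN ler_wpM2r// DM.
Qed.

(** [Ck] provides partial derivatives only, so the path from [y] to [x] changes one coordinate at a
    time: [w m] has the first m coordinates of [x] and the others of [y]. Each of the d steps costs
    at most [M * enorm (x - y)]. *)
Lemma lipschitz_of_partials u (M : R) : 0 <= M ->
  (forall i x, derivable u x (delta_mx ord0 i)) ->
  (forall i x j, `|'D_(delta_mx ord0 i) u x ord0 j| <= M) ->
  forall x y j, `|u x ord0 j - u y ord0 j| <= d%:R * (M * enorm (x - y)).
Proof.
move=> M0 du DM x y j.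
pose w (m : nat) : Rd := \row_i (if (i < m)%N then x ord0 i else y ord0 i).
have w0 : w 0%N = y by apply/rowP => i; rewrite mxE.
have wd : w d = x by apply/rowP => i; rewrite mxE ltn_ord.
suff H m : (m <= d)%N -> `|u (w m) ord0 j - u y ord0 j| <= m%:R * (M * enorm (x - y)).
  by rewrite -{1}wd; exact: H.
elim: m => [_|m IH md].
  by rewrite w0 subrr normr0 mul0r.
have -> : w m.+1 = w m + (x - y) ord0 (Ordinal md) *: delta_mx ord0 (Ordinal md).
  apply/rowP => i; rewrite !mxE eqxx /= ltnS leq_eqVlt -(inj_eq val_inj) /=.
  case: eqVneq => [im|im] /=; last by rewrite mulr0 addr0.
  rewrite im ltnn mulr1 addrC.
  by rewrite (_ : Ordinal md = i) ?subrK//; exact: val_inj.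
rewrite -(subrKA (u (w m) ord0 j)) (le_trans (ler_normD _ _))//.
rewrite -natr1 mulrDl mul1r addrC lerD//; last first.
  rewrite (le_trans (coordinate_step_le _ _ _ (du _) (DM _) _ _ _))//.
  by rewrite ler_wpM2l// coor_le_enorm.
by apply: IH; exact: ltnW.
Qed.

Lemma continuous_box_bounded u N : continuous u -> (forall x, ~ box N x -> u x = 0) ->
  exists2 M : R, 0 <= M & forall x j, `|u x ord0 j| <= M.
Proof.
move=> cu u0.
have : compact (u @` box N).
  by apply: continuous_compact (compact_box N); exact: continuous_subspaceT.
move=> /compact_bounded[M [Mr H]]; exists (`|M| + 1) => [|x j].
  by rewrite addr_ge0.
have [xN|/u0 ->] := pselect (box N x); last by rewrite mxE normr0 addr_ge0.
rewrite (le_trans (coor_le_norm _ _))//; apply: (H (`|M| + 1)); last by exists x.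
by rewrite (le_lt_trans (ler_norm M))// ltrDl.
Qed.

(** The complement of the support is open, so the difference quotients at [x] vanish for small
    increments. The partial derivatives of a test function are thus continuous and zero outside a
    box, hence bounded. *)
Lemma derive_out_support u x e : ~ Defs.support u x -> 'D_e u x = 0.
Proof.
move=> xs.
have nu : \forall y \near x, u y = 0.
  have : open (~` Defs.support u) by apply: closed_openC; exact: closed_closure.
  rewrite openE => /(_ _ xs); apply: filterS => y ys.
  by apply: contrapT => /eqP uy; apply: ys; exact: subset_closure.
apply: cvg_lim => //; apply: cvg_near_cst.
have hx : h *: e + x @[h --> (0 : R)] --> (0 : R) *: e + x.
  by apply: cvgD; [apply: cvgZr_tmp; exact: cvg_id|exact: cvg_cst].
rewrite scale0r add0r in hx.
have /(@cvg_within _ (nbhs (0 : R))) := hx _ nu.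
move=> /(_ [set h : R | h != 0]); apply: filterS => h /= uh.
by rewrite uh (nbhs_singleton nu) subr0 scaler0.
Qed.

Lemma Cc_smooth_estimate (Omega : set Rd) u : Cc_smooth Omega u ->
  [/\ measurable_fun setT u,
      exists N, forall x, ~ box N x -> u x = 0,
      exists2 M : R, 0 <= M & forall x, enorm (u x) ^+ 2 <= M &
      exists2 C : R, 0 <= C &
        forall z, Dop u z ^+ 2 <= C * Num.min 1 (enorm (z.1 - z.2) ^+ 2)].
Proof.
move=> [Cu /compact_sub_box[N suppN] _].
have cu : continuous u := Cu 0%N.
have [_ Du] := Cu 1%N.
have u0 x : ~ box N x -> u x = 0.
  move=> xN; apply: contrapT => /eqP ux; apply: xN; apply: suppN.
  exact: subset_closure.
have [M M0 uM] := continuous_box_bounded u N cu u0.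
have [D D0 DM] : exists2 D : R, 0 <= D &
    forall i x j, `|'D_(delta_mx ord0 i) u x ord0 j| <= D.
  have /choice[D_ HD] (i : 'I_d) : exists D : R, 0 <= D /\
      forall x j, `|'D_(delta_mx ord0 i) u x ord0 j| <= D.
    have [D D0 HD] := continuous_box_bounded ('D_(delta_mx ord0 i) u) N (Du i).2
      (fun x xN => derive_out_support _ _ _ (fun xs => xN (suppN _ xs))).
    by exists D.
  exists (\sum_i D_ i) => [|i x j]; first by apply: sumr_ge0 => i _; have [] := HD i.
  rewrite (le_trans ((HD i).2 x j))// (bigD1 i)//= lerDl.
  by apply: sumr_ge0 => i' _; have [] := HD i'.
have M2 x : enorm (u x) ^+ 2 <= d%:R * M ^+ 2.
  by apply: enorm_sqr_le => j; exact: uM.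
split.
- exact: continuous_measurable_vfield.
- by exists N.
- by exists (d%:R * M ^+ 2) => //; rewrite mulr_ge0// sqr_ge0.
(* [C1] comes from the boundedness of [u] and [|a - b|^2 <= 2 (|a|^2 + |b|^2)]; [C2] comes from the
   Lipschitz bound on each of the d coordinates. Their sum serves for either value of the
   minimum. *)
pose C1 := 4 * (d%:R * M ^+ 2) : R.
pose C2 := d%:R * (d%:R * D) ^+ 2 : R.
have C10 : 0 <= C1 by rewrite !mulr_ge0// sqr_ge0.
have C20 : 0 <= C2 by rewrite !mulr_ge0// sqr_ge0.
exists (C1 + C2) => [|z]; first by rewrite addr_ge0.
have b1 : Dop u z ^+ 2 <= C1.
  rewrite (le_trans (dotp_dir_sqr_le _ _))// (le_trans (enormD_sqr _ _))// enormN.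
  rewrite /C1; have := M2 z.1; have := M2 z.2.
  by move: (enorm _ ^+ 2) (enorm _ ^+ 2) (d%:R * M ^+ 2) => a b c; lra.
have b2 : Dop u z ^+ 2 <= C2 * enorm (z.1 - z.2) ^+ 2.
  rewrite (le_trans (dotp_dir_sqr_le _ _))//.
  have -> : C2 * enorm (z.1 - z.2) ^+ 2 = d%:R * (d%:R * (D * enorm (z.1 - z.2))) ^+ 2.
    by rewrite /C2 !exprMn; ring.
  apply: enorm_sqr_le => j; rewrite mxE [X in _ + X]mxE.
  exact: (lipschitz_of_partials u D D0 (fun i => (Du i).1) DM).
have e0 : 0 <= enorm (z.1 - z.2) ^+ 2 by rewrite sqr_ge0.
rewrite /Num.min; case: ifPn => _.
  by rewrite mulr1 (le_trans b1)// lerDl.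
by rewrite (le_trans b2)// mulrDl lerDr mulr_ge0.
Qed.

End smooth_lipschitz.

(** * Truncated kernels *)

Section truncated_kernel.
Context {R : realType} {d : nat}.
Local Notation Rd := 'rV[R]_d.
Local Notation vfield := (Rd -> Rd).
Local Notation leb := (@lebesgue_rV R d).
Local Notation leb2 := (@lebesgue_rV R d \x @lebesgue_rV R d)%E.
Variable k : Rd * Rd -> \bar R.
Hypothesis mk : measurable_fun [set: Rd * Rd] k.
Hypothesis k_ge0 : forall z, (0 <= k z)%E.
Hypothesis kSM : condSM k.
Local Open Scope ereal_scope.
Implicit Types (u v : vfield) (z : Rd * Rd).

Let ks0 := ksym_ge0 k k_ge0.
Let mks := measurable_ksym k mk.

Definition min1sq z : R := Num.min 1%R (enorm (z.1 - z.2) ^+ 2)%R.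

(** The integrand of (SM) as a function on the product space, where it is invariant under the
    exchange of x and y. *)
Definition levy_kernel z : \bar R := (min1sq z)%:E * ksym k z.

Lemma min1sq_ge0 z : (0 <= min1sq z)%R.
Proof. by rewrite le_min ler01 sqr_ge0. Qed.

Lemma min1sq_swap z : min1sq (z.2, z.1) = min1sq z.
Proof. by rewrite /min1sq /= -opprB enormN. Qed.

Lemma measurable_min1sq : measurable_fun setT min1sq.
Proof.
apply: measurable_minr => //; apply: measurable_funX; apply: measurable_enorm.
exact: measurable_rVB.
Qed.

Lemma levy_kernel_ge0 z : 0 <= levy_kernel z.
Proof. by rewrite mule_ge0// lee_fin min1sq_ge0. Qed.

Lemma measurable_levy_kernel : measurable_fun setT levy_kernel.
Proof.
by apply: emeasurable_funM => //; apply/measurable_EFinP; exact: measurable_min1sq.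
Qed.

Lemma levy_kernel_swap z : levy_kernel (z.2, z.1) = levy_kernel z.
Proof. by rewrite /levy_kernel min1sq_swap ksym_swap. Qed.

Definition levy_mass (x : Rd) : \bar R := \int[leb]_y levy_kernel (x, y).

Lemma integrable_levy_mass N : leb.-integrable (box N) levy_mass.
Proof. by apply: kSM; exact: compact_box. Qed.

Lemma levy_mass_ge0 x : 0 <= levy_mass x.
Proof. by apply: integral_ge0 => y _; exact: levy_kernel_ge0. Qed.

(** (SM) gives finiteness almost everywhere on each box, and countably many boxes cover the
    space. *)
Lemma ae_levy_mass_fin : {ae leb, forall x, levy_mass x < +oo}.
Proof.
have : {ae leb, forall x, forall N, box N x -> levy_mass x \is a fin_num}.
  apply: ae_foralln => N.
  exact: (integrable_ae (measurable_box N) (integrable_levy_mass N)).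
apply: filterS => x H; have [N xN] := box_cover x.
by rewrite -ge0_fin_numE ?levy_mass_ge0//; exact: H xN.
Qed.

(** Only the first variable is confined to the box, because (SM) is local in x but integrates over
    all y. This is the integrable majorant for test functions. *)
Definition box_kernel N z : \bar R := (\1_(box N) z.1)%:E * levy_kernel z.

Lemma box_kernel_ge0 N z : 0 <= box_kernel N z.
Proof. by rewrite mule_ge0 ?levy_kernel_ge0// lee_fin. Qed.

Lemma measurable_box_kernel N : measurable_fun setT (box_kernel N).
Proof.
apply: emeasurable_funM; last exact: measurable_levy_kernel.
apply/measurable_EFinP; apply: measurableT_comp => //.
by apply: measurable_indic; exact: measurable_box.
Qed.

Lemma integral_box_kernel_lty N : \int[leb2]_z box_kernel N z < +oo.
Proof.
rewrite (@fubini_tonelli1 _ _ _ _ _ leb leb)//; first last.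
- by move=> z; exact: box_kernel_ge0.
- exact: measurable_box_kernel.
have /integrableP[_] := integrable_levy_mass N; apply: le_lt_trans.
rewrite [leRHS]integral_mkcond le_eqVlt; apply/orP; left; apply/eqP.
apply: eq_integral => x _; rewrite /fubini_F patchE /box_kernel /= indicE.
case: ifPn => xN.
  rewrite gee0_abs ?levy_mass_ge0//.
  by under eq_integral do rewrite mul1e.
by under eq_integral do rewrite mul0e; rewrite integral0.
Qed.

Lemma integrable_box_kernel N : leb2.-integrable setT (box_kernel N).
Proof.
apply/integrableP; split; first exact: measurable_box_kernel.
under eq_integral do rewrite gee0_abs ?box_kernel_ge0//.
exact: integral_box_kernel_lty.
Qed.

(** D(u) vanishes unless x or y lies in the box containing the support, so k_s D(u)^2 is at most [C]
    times [box_kernel] plus its swap, and the swap has the same finite integral. *)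
Lemma Cc_smooth_Sspace (Omega : set Rd) u : Cc_smooth Omega u -> Sspace k u.
Proof.
move=> /Cc_smooth_estimate[mu [N u0] [M M0 uM] [C C0 uC]].
apply/SspaceP => //; split=> //.
- apply: (@le_lt_trans _ _ (\int[leb]_(x in box N) M%:E)); last first.
    rewrite integral_cst; last exact: measurable_box.
    by rewrite lte_mul_pinfty ?lee_fin// lebesgue_box_lty.
  rewrite [leRHS]integral_mkcond; apply: ge0_le_integral => //.
  + by move=> x _; rewrite lee_fin sqr_ge0.
  + exact: measurable_enorm_sqr.
  + by apply/(measurable_restrictT _ (measurable_box N)).
  + move=> x _; rewrite patchE; case: ifPn => [_|]; first by rewrite lee_fin.
    by rewrite notin_setE => /u0 ->; rewrite enorm0 expr0n.
- have mB : measurable_fun setT (fun z : Rd * Rd => box_kernel N (z.2, z.1)).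
    by apply: measurable_swapped; exact: measurable_box_kernel.
  apply: (@le_lt_trans _ _ (\int[leb2]_z
      (C%:E * (box_kernel N z + box_kernel N (z.2, z.1))))).
    apply: ge0_le_integral => //.
    + by move=> z _; rewrite mule_ge0// lee_fin sqr_ge0.
    + exact: measurable_ksym_Dop.
    + apply: measurable_funeM; apply: emeasurable_funD => //.
      exact: measurable_box_kernel.
    + move=> z _; rewrite /box_kernel levy_kernel_swap /= -ge0_muleDl ?lee_fin//.
      have B : (Dop u z ^+ 2 <= C * ((\1_(box N) z.1 + \1_(box N) z.2) * min1sq z))%R.
        have [zN|zN] := boolP ((z.1 \in box N) || (z.2 \in box N)).
          rewrite (le_trans (uC z))// ler_wpM2l// ler_peMl ?min1sq_ge0// !indicE.
          by case/orP: zN => ->; rewrite ?lerDl ?lerDr ler0n.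
        move: zN; rewrite negb_or => /andP[]; rewrite !notin_setE => /u0 u1 /u0 u2.
        rewrite DopE u1 u2 !dotp0l.
        by rewrite addr0 expr0n /= mulr_ge0// mulr_ge0 ?min1sq_ge0// addr_ge0.
      rewrite /levy_kernel; move: (ksym k z) (ks0 z) => K K0.
      rewrite muleC !muleA -!EFinD -!EFinM lee_wpmul2r// lee_fin.
      by rewrite -mulrA.
  rewrite ge0_integralZl//; first last.
  + by move=> z _; rewrite adde_ge0// box_kernel_ge0.
  + by apply: emeasurable_funD => //; exact: measurable_box_kernel.
  rewrite ge0_integralD//; first last.
  + by move=> z _; exact: box_kernel_ge0.
  + exact: measurable_box_kernel.
  + by move=> z _; exact: box_kernel_ge0.
  rewrite ge0_integral_swap; first last.
  + by move=> z; exact: box_kernel_ge0.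
  + exact: measurable_box_kernel.
  by rewrite lte_mul_pinfty// lte_add_pinfty// integral_box_kernel_lty.
Qed.

(** On D_n with n positive, both 1 and |x - y|^2 are at least 1/n^2, so [min1sq] is too; the factor
    2 comes from k <= 2 k_s. *)
Lemma k_le_levy n z : (0 < n)%N -> Dset n z ->
  k z <= (2 * n%:R ^+ 2)%:E * levy_kernel z.
Proof.
move=> n0 nz; rewrite (le_trans (k_le_ksym k k_ge0 z))// /levy_kernel [leRHS]muleA.
rewrite -EFinM lee_wpmul2r// lee_fin -mulrA ler_peMr//.
have n1 : (0 < n%:R ^+ 2 :> R)%R by rewrite exprn_gt0// ltr0n.
rewrite -ler_pdivrMl// mulr1 -exprVn le_min.
have ninv : (0 <= n%:R^-1 :> R)%R by rewrite invr_ge0.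
rewrite exprn_ile1//=; last by rewrite invf_le1 ?ltr0n// ler1n.
by rewrite lerXn2r ?nnegrE ?enorm_ge0// ltW.
Qed.

End truncated_kernel.

(** * The truncated operator and its pairing with a test function *)

Section truncated_operator.
Context {R : realType} {d : nat}.
Local Notation Rd := 'rV[R]_d.
Local Notation vfield := (Rd -> Rd).
Local Notation leb := (@lebesgue_rV R d).
Local Notation leb2 := (@lebesgue_rV R d \x @lebesgue_rV R d)%E.
Variable k : Rd * Rd -> \bar R.
Hypothesis mk : measurable_fun [set: Rd * Rd] k.
Hypothesis k_ge0 : forall z, (0 <= k z)%E.
Hypothesis kSM : condSM k.
Variables (u v : vfield) (N : nat) (C M : R).
Hypotheses (mu : measurable_fun [set: Rd] u) (mv : measurable_fun [set: Rd] v).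
Hypotheses (C0 : 0 <= C) (uC : forall z, Dop u z ^+ 2 <= C).
Hypotheses (v0 : forall x, ~ box N x -> v x = 0)
  (M0 : 0 <= M) (vM : forall x, enorm (v x) ^+ 2 <= M).
Variable n : nat.
Hypothesis n0 : (0 < n)%N.
Local Open Scope ereal_scope.

Let levy := levy_kernel k.

Lemma normr_Dop_dotp_le z :
  (`|Dop u z * dotp (v z.1) (dir z)| <= (C + M) * \1_(box N) z.1)%R.
Proof.
rewrite indicE; have [zN|] := boolP (z.1 \in box N); last first.
  by rewrite notin_setE => /v0 ->; rewrite dotp0l !mulr0 normr0.
rewrite mulr1 (le_trans (am_gm_real 1 _ _ ltr01))//.
have := uC z; have := le_trans (dotp_dir_sqr_le (v z.1) z) (vM z.1).
move: (Dop u z ^+ 2)%R (dotp (v z.1) (dir z) ^+ 2)%R (sqr_ge0 (Dop u z)) C0 M0.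
move=> a b *; rewrite invr1; lra.
Qed.

Let Fn_patch := Fn_integrand k u v \_ (Dset n).

(** The support of [v] confines x to a box and the truncation gives [k_le_levy]; together they bound
    the integrand by a multiple, depending on n, of [box_kernel]. *)
Lemma integrable_Fn_patch : leb2.-integrable setT Fn_patch.
Proof.
have := integrableZl measurableT ((C + M) * (2 * n%:R ^+ 2))%R
  (integrable_box_kernel k mk k_ge0 kSM N).
apply: le_integrable => //.
  apply/(measurable_restrictT _ (measurable_Dset n)).
  by apply: measurable_funS (measurable_Fn_integrand k mk u v mu mv).
move=> z _; rewrite /Fn_patch patchE; case: ifPn => [|_]; last by rewrite abse0.
rewrite inE => zn; rewrite /Fn_integrand abseM (gee0_abs (k_ge0 z)).
rewrite [leRHS]gee0_abs; last first.
  by rewrite mule_ge0 ?box_kernel_ge0// lee_fin !mulr_ge0 ?sqr_ge0 ?addr_ge0.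
have kl := k_le_levy k k_ge0 n z n0 zn.
apply: (@le_trans _ _ (((2 * n%:R ^+ 2)%:E * levy z) *
    ((C + M) * \1_(box N) z.1)%:E)).
  by rewrite lee_pmul// lee_fin normr_Dop_dotp_le.
rewrite /box_kernel -/levy; move: (levy z) => L.
rewrite muleAC -EFinM muleA -EFinM le_eqVlt; apply/orP; left; apply/eqP.
by congr (_%:E * _); ring.
Qed.

Lemma Fn_definedP : Fn_defined k n u v.
Proof.
by apply/(integrable_mkcond _ (measurable_Dset n)); exact: integrable_Fn_patch.
Qed.

(** Tonelli applies to the positive and negative parts separately, so no integrability is required.
    This matters for L_n u alone, which lacks the cut-off in x that [v] provides. *)
Lemma measurable_fubini_section (f : Rd * Rd -> \bar R) : measurable_fun setT f ->
  measurable_fun setT (fun x => \int[leb]_y f (x, y)).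
Proof.
move=> mf; rewrite (_ : (fun _ => _) = (fun x => \int[leb]_y f^\+ (x, y)) \-
    (fun x => \int[leb]_y f^\- (x, y))).
  apply: emeasurable_funB; apply: measurable_fun_fubini_tonelli_F => //.
    exact: measurable_funepos.
  exact: measurable_funeneg.
apply/funext => x; rewrite [LHS]integralE.
under eq_integral do rewrite funepos_comp/=.
by under [X in _ - X = _]eq_integral do rewrite funeneg_comp/=.
Qed.

Let A x := Ln_domain (R:=R) (d:=d) n x.

Let mA x : measurable (A x).
Proof.
rewrite -[X in measurable X]setTI (_ : A x = pair x @^-1` Dset n)//.
by apply: pair1_measurable => //; exact: measurable_Dset.
Qed.

Lemma integrable_k_section x : levy_mass k x < +oo ->
  leb.-integrable (A x) (fun y => k (x, y)).
Proof.
move=> lx; have mkx : measurable_fun setT (fun y => k (x, y)).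
  by apply: measurableT_comp => //; exact: pair1_measurable.
have mlx : measurable_fun setT (fun y => levy (x, y)).
  apply: measurableT_comp; last exact: pair1_measurable.
  exact: measurable_levy_kernel.
have levy0 z : 0 <= levy z by exact: levy_kernel_ge0.
have ilx : leb.-integrable setT (fun y => levy (x, y)).
  by apply/integrableP; split => //; under eq_integral do rewrite gee0_abs//.
have := integrableS measurableT (mA x) (@subsetT _ _)
  (integrableZl measurableT (2 * n%:R ^+ 2)%R ilx).
apply: le_integrable => //; first exact: measurable_funS mkx.
move=> y xy; rewrite gee0_abs// gee0_abs; first exact: k_le_levy.
by rewrite mule_ge0// lee_fin mulr_ge0// sqr_ge0.
Qed.

Lemma integrable_k_section_mul x (a : Rd -> R) (b : R) : levy_mass k x < +oo ->
  measurable_fun setT a -> (forall y, `|a y| <= b)%R ->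
  leb.-integrable (A x) (fun y => k (x, y) * (a y)%:E).
Proof.
move=> lx ma ab; have ix := integrable_k_section x lx.
have := integrableZl (mA x) b ix; apply: le_integrable => //.
  apply: emeasurable_funM; first exact: measurable_int ix.
  by apply/measurable_EFinP; exact: measurable_funS ma.
move=> y xy; have b0 : (0 <= b)%R by rewrite (le_trans _ (ab y)).
rewrite abseM muleC abseM abse_EFin abse_EFin (ger0_norm b0) lee_wpmul2r//.
by rewrite lee_fin.
Qed.

Lemma dir_coor_le1 (z : Rd * Rd) i : (`|dir z ord0 i| <= 1)%R.
Proof.
rewrite (le_trans (coor_le_enorm _ _))// -(@ler_sqr R _ 1)%R ?nnegrE ?enorm_ge0//.
by rewrite enorm_sqr expr1n dir_dotp_le1.
Qed.

Lemma Ln_integrable x i : levy_mass k x < +oo ->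
  leb.-integrable (A x) (Ln_integrand k u x i).
Proof.
move=> lx; apply: (integrable_k_section_mul x _ (C + 1)) => //.
  apply: measurable_funM.
    by apply: (measurableT_comp (measurable_Dop u mu)); exact: pair1_measurable.
  apply: measurable_coordP; apply: (measurableT_comp measurable_dir).
  exact: pair1_measurable.
move=> y; rewrite (le_trans (am_gm_real 1 _ _ ltr01))// invr1.
have := uC (x, y); have : (dir (x, y) ord0 i ^+ 2 <= 1)%R.
  by rewrite -[X in (X <= _)%R]real_normK ?num_real// exprn_ile1// dir_coor_le1.
move: (Dop u _ ^+ 2)%R (dir _ _ _ ^+ 2)%R C0 => a b *; lra.
Qed.

Lemma ae_Ln_defined : {ae leb, forall x, Ln_defined k n u x}.
Proof.
apply: filterS (ae_levy_mass_fin k k_ge0 kSM) => x lx i.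
exact: Ln_integrable.
Qed.

Lemma measurable_Ln : measurable_fun setT (Ln k n u).
Proof.
apply/measurable_fun_coorP => i; under eq_fun do rewrite mxE.
apply: (measurableT_comp (fine_measurable measurableT)) => //.
pose h z := k z * (Dop u z * dir z ord0 i)%:E.
have mh : measurable_fun setT h.
  apply: emeasurable_funM => //; apply/measurable_EFinP.
  apply: measurable_funM; first exact: measurable_Dop.
  by apply: measurable_coordP; exact: measurable_dir.
rewrite (_ : (fun _ => _) = fun x => \int[leb]_y (h \_ (Dset n)) (x, y)).
  apply: measurable_fubini_section; apply/(measurable_restrictT _ (measurable_Dset n)).
  exact: measurable_funS mh.
apply/funext => x; rewrite integral_mkcond; apply: eq_integral => y _.
by rewrite !patchE !mem_setE.
Qed.

(** Each coordinate of L_n u(x) is a convergent integral, so the finite sum moves inside. The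
    summands recombine into the integrand of F_n wherever k(x, y) is finite, that is, for almost
    every y of the section. *)
Lemma dotp_LnE x : levy_mass k x < +oo ->
  (dotp (Ln k n u x) (v x))%:E = \int[leb]_y Fn_patch (x, y).
Proof.
move=> lx; rewrite /dotp -sumEFin.
transitivity (\sum_(i < d)
    \int[leb]_(y in A x) (Ln_integrand k u x i y * (v x ord0 i)%:E)).
  apply: eq_bigr => i _; rewrite mxE EFinM integralZr//; last exact: Ln_integrable.
  by rewrite fineK//; apply: integrable_fin_num => //; exact: Ln_integrable.
rewrite -integral_sum//; last first.
  move=> i; have := integrableZr (mA x) (v x ord0 i) (Ln_integrable x i lx).
  by [].
transitivity (\int[leb]_(y in A x) Fn_integrand k u v (x, y)); last first.
  rewrite [LHS]integral_mkcond; apply: eq_integral => y _.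
  by rewrite /Fn_patch !patchE !mem_setE.
have mx2 (f : Rd * Rd -> \bar R) : measurable_fun setT f ->
    measurable_fun (A x) (fun y => f (x, y)).
  move=> mf; apply: (@measurable_funS _ _ _ _ setT) => //.
  by apply: measurableT_comp => //; exact: pair1_measurable.
apply: ae_eq_integral => //.
- apply: emeasurable_sum => i; apply: emeasurable_funM => //.
  exact: measurable_int (Ln_integrable x i lx).
- by apply: mx2; exact: measurable_Fn_integrand.
- apply: filterS (integrable_ae (mA x) (integrable_k_section x lx)) => y h xy.
  move: (h xy); rewrite /Ln_integrand /Fn_integrand; case: (k (x, y)) => [r| |]// _.
  under eq_bigr do rewrite -!EFinM; rewrite sumEFin -EFinM; congr _%:E.
  rewrite /dotp /= !mulr_sumr; apply: eq_bigr => i _; ring.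
Qed.

(** Outside the null set of x with infinite [levy_mass], the scalar product equals the inner
    y-integral of the truncated integrand. Fubini then yields both its integrability and the value
    of its integral. *)
Lemma L2pair_Ln : L2pair_defined (Ln k n u) v /\ L2pair (Ln k n u) v = Fn k n u v.
Proof.
have iF := integrable_Fn_patch.
have iG := integrable_fubini_F iF.
have mL : measurable_fun setT (fun x => (dotp (Ln k n u x) (v x))%:E).
  apply/measurable_EFinP; apply: measurable_dotp => //; exact: measurable_Ln.
have ae : ae_eq leb setT (fun x => (dotp (Ln k n u x) (v x))%:E)
    (fubini_F leb Fn_patch).
  by apply: filterS (ae_levy_mass_fin k k_ge0 kSM) => x lx _; exact: dotp_LnE.
split.
  apply/integrableP; split => //; have /integrableP[mG] := iG.
  apply: le_lt_trans; rewrite le_eqVlt; apply/orP; left; apply/eqP.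
  apply: ge0_ae_eq_integral => //; try exact: measurableT_comp.
  by apply: filterS ae => x + xT => ->.
rewrite /L2pair /Rintegral /Fn; congr fine.
rewrite [RHS]integral_mkcond -(integral12_prod_meas1 iF).
by apply: ae_eq_integral => //; exact: measurable_int iG.
Qed.

End truncated_operator.

(** * Symmetrization of F_n and passage to the limit *)

Section truncation_limit.
Context {R : realType} {d : nat}.
Local Notation Rd := 'rV[R]_d.
Local Notation vfield := (Rd -> Rd).
Local Notation leb := (@lebesgue_rV R d).
Local Notation leb2 := (@lebesgue_rV R d \x @lebesgue_rV R d)%E.

Lemma Dset_swap n (z : Rd * Rd) : Dset n (z.2, z.1) = Dset n z.
Proof. by rewrite /Dset /= -[z.2 - z.1]opprB enormN. Qed.

(** Dominated convergence with majorant |f|. The indicators of D_n tend to 1 off the diagonal, and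
    [f] vanishes on it, so convergence holds at every point without measuring the diagonal, which
    has positive measure when d = 0. *)
Lemma cvg_Rintegral_Dset (f : Rd * Rd -> R) :
  leb2.-integrable setT (EFin \o f) ->
  (forall z, enorm (z.1 - z.2) = 0 -> f z = 0) ->
  \int[leb2]_z (\1_(Dset n) z * f z) @[n --> \oo] --> \int[leb2]_z f z.
Proof.
move=> fi f0; rewrite /Rintegral; apply: fine_cvg.
rewrite fineK; last exact: integrable_fin_num.
have mf := measurable_int leb2 fi.
have mD n : measurable_fun setT (fun z => (\1_(Dset n) z * f z)%:E).
  apply/measurable_EFinP; apply: measurable_funM; last exact/measurable_EFinP.
  by apply: measurable_indic; exact: measurable_Dset.
have Df : {ae leb2, forall z, setT z ->
    (\1_(Dset n) z * f z)%:E @[n --> \oo] --> (EFin \o f) z}.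
  apply: aeW => z _; apply: cvg_near_cst.
  have [e0|e0] := eqVneq (enorm (z.1 - z.2)) 0.
    by apply: nearW => n; rewrite /= f0// mulr0.
  have ep : 0 < enorm (z.1 - z.2) by rewrite lt_neqAle eq_sym e0 enorm_ge0.
  near=> n; rewrite /= indicE mem_set ?mul1r//=.
  rewrite /Dset /= -[ltRHS]invrK ltf_pV2 ?posrE ?invr_gt0//; last first.
    by rewrite ltr0n; near: n; exact: nbhs_infty_gt.
  by near: n; exact: nbhs_infty_gtr.
have fD : {ae leb2, forall z n, setT z ->
    (`|(\1_(Dset n) z * f z)%:E| <= (abse \o (EFin \o f)) z)%E}.
  apply: aeW => z n _; rewrite lee_fin normrM indicE.
  by case: (z \in _); rewrite ?normr1 ?mul1r// normr0 mul0r.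
by have [_ _] := dominated_convergence measurableT mD mf Df (integrable_abse fi) fD.
Unshelve. all: by end_near. Qed.

Variable k : Rd * Rd -> \bar R.
Hypothesis mk : measurable_fun [set: Rd * Rd] k.
Hypothesis k_ge0 : forall z, (0 <= k z)%E.
Variables u v : vfield.
Hypotheses (Su : Sspace k u) (Sv : Sspace k v) (uvF : Fform_defined k u v).

Let mu : measurable_fun setT u. Proof. by case: Su. Qed.
Let mv : measurable_fun setT v. Proof. by case: Sv. Qed.

Let mks := measurable_ksym k mk.

Let P n z : R := \1_(Dset n) z * (fine (ksym k z) * (Dop u z * dotp (v z.1) (dir z))).

Let mP n : measurable_fun setT (P n).
Proof.
apply: measurable_funM; first by apply: measurable_indic; exact: measurable_Dset.
apply: measurable_funM; first exact: (measurable_fine_comp _ _ _ mks).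
by apply: measurable_funM; [exact: measurable_Dop|exact: measurable_dotp_dir].
Qed.

Let integrable_Fanti_Dset n :
  leb2.-integrable setT (EFin \o (fun z => \1_(Dset n) z * Fanti_real k u v z)).
Proof.
have := integrable_Fanti_real k mk u v Su Sv uvF; apply: le_integrable => //.
  apply/measurable_EFinP; apply: measurable_funM.
    by apply: measurable_indic; exact: measurable_Dset.
  exact: (measurable_Fanti_real k mk u v mu mv).
move=> z _; rewrite lee_fin normrM indicE.
by case: (z \in _); rewrite ?normr1 ?mul1r// normr0 mul0r.
Qed.

Section fixed_n.
Variable n : nat.
Hypothesis nF : Fn_defined k n u v.

Let ae_Fn_patch : ae_eq leb2 setT (Fn_integrand k u v \_ (Dset n))
  (fun z => (P n z + \1_(Dset n) z * Fanti_real k u v z)%:E).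
Proof.
apply: filterS (ae_ksym_Dop k mk k_ge0 u Su) => z kz _.
rewrite patchE /P indicE; case: ifPn => _; last by rewrite !mul0r addr0.
rewrite !mul1r /Fn_integrand /Fanti_real.
case: kz => [kz|->]; last by rewrite !mul0r !mulr0 mule0 addr0.
have [E _ _] := kernel_decomp k k_ge0 z kz.
by rewrite -mulrDl -E [in RHS]EFinM fineK//; have [] := ksym_lty_fin k k_ge0 z kz.
Qed.

(** Obtained by difference: the whole integrand of F_n is integrable on D_n, and so is its k_a
    part. *)
Let iP : leb2.-integrable setT (EFin \o P n).
Proof.
have iF : leb2.-integrable setT (Fn_integrand k u v \_ (Dset n)).
  exact/(integrable_mkcond _ (measurable_Dset n)).
have iPA : leb2.-integrable setT
    (fun z => (P n z + \1_(Dset n) z * Fanti_real k u v z)%:E).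
  have mPA : measurable_fun setT
      (fun z => (P n z + \1_(Dset n) z * Fanti_real k u v z)%:E).
    apply/measurable_EFinP; apply: measurable_funD => //.
    by have /measurable_int/measurable_EFinP := integrable_Fanti_Dset n.
  apply/integrableP; split => //.
  have /integrableP[mF] := iF; apply: le_lt_trans.
  rewrite le_eqVlt; apply/orP; left; apply/eqP.
  apply: ge0_ae_eq_integral => //; try exact: measurableT_comp.
  by apply: filterS ae_Fn_patch => z + zT => ->.
have := integrableB measurableT iPA (integrable_Fanti_Dset n).
apply: eq_integrable => // z _ /=.
by rewrite -EFinB addrK.
Qed.

(* Swapping x and y fixes D_n, k_s and D(u) and reverses the direction, so
   averaging P with its swap turns v(x) . dir into D(v) / 2. *)
Let Rintegral_P : \int[leb2]_z P n z =
  2^-1 * \int[leb2]_z (\1_(Dset n) z * Fsym_real k u v z).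
Proof.
have E : \int[leb2]_z P n (z.2, z.1) = \int[leb2]_z P n z.
  rewrite /Rintegral; congr fine; exact: (integral_swap (EFin \o P n)).
have -> : \int[leb2]_z (\1_(Dset n) z * Fsym_real k u v z) =
    \int[leb2]_z (P n z + P n (z.2, z.1)).
  apply: eq_Rintegral => z _.
  rewrite /P /Fsym_real !indicE Dop_swap ksym_swap (DopE v z).
  have -> : ((z.2, z.1) \in Dset n) = (z \in Dset n).
    by apply/idP/idP; rewrite !inE Dset_swap.
  by rewrite /=; ring.
have iPs : leb2.-integrable setT (EFin \o (fun z => P n (z.2, z.1))).
  exact: (integrable_swap (EFin \o P n)).
rewrite (RintegralD measurableT iP iPs).
by rewrite E; field.
Qed.

Lemma Fn_symmetrized : Fn k n u v =
  2^-1 * (\int[leb2]_z (\1_(Dset n) z * Fsym_real k u v z)) +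
  \int[leb2]_z (\1_(Dset n) z * Fanti_real k u v z).
Proof.
rewrite -Rintegral_P -(RintegralD measurableT iP (integrable_Fanti_Dset n)).
rewrite /Fn integral_mkcond /Rintegral; congr fine.
apply: ae_eq_integral => //.
- apply/(measurable_restrictT _ (measurable_Dset n)).
  by apply: measurable_funS (measurable_Fn_integrand k mk u v mu mv).
- apply/measurable_EFinP; apply: measurable_funD => //.
  by have /measurable_int/measurable_EFinP := integrable_Fanti_Dset n.
Qed.

End fixed_n.

Lemma Dop_diag (w : vfield) z : enorm (z.1 - z.2) = 0 -> Dop w z = 0.
Proof. by move=> e0; rewrite /Dop /dir e0 invr0 dotpZr mul0r. Qed.

Lemma cvg_Fn : (forall n, (0 < n)%N -> Fn_defined k n u v) ->
  Fn k n u v @[n --> \oo] --> Fform k u v.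
Proof.
move=> nF; rewrite (FformE k mk k_ge0 u v Su Sv).
have diag z : enorm (z.1 - z.2) = 0 -> Fsym_real k u v z = 0 /\ Fanti_real k u v z = 0.
  by move=> /(Dop_diag u) Du; rewrite /Fsym_real /Fanti_real Du !mul0r !mulr0.
apply: cvg_trans (_ : 2^-1 * (\int[leb2]_z (\1_(Dset n) z * Fsym_real k u v z)) +
  \int[leb2]_z (\1_(Dset n) z * Fanti_real k u v z) @[n --> \oo] --> _).
  (* Only n > 0 is available: with [0^-1 = 0], the set D_0 is everything off the diagonal, where
     integrability is not granted. *)
  apply: near_eq_cvg; near=> n; rewrite Fn_symmetrized//; apply: nF.
  by near: n; exact: nbhs_infty_gt.
apply: cvgD.
  apply: cvgM; first exact: cvg_cst.
  apply: cvg_Rintegral_Dset; first exact: integrable_Fsym_real.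
  by move=> z /diag [].
apply: cvg_Rintegral_Dset; first exact: integrable_Fanti_real.
by move=> z /diag [].
Unshelve. all: by end_near. Qed.

End truncation_limit.

Theorem proposition2p2 (R : realType) (d : nat) (Omega : set 'rV[R]_d)
    (k : 'rV[R]_d * 'rV[R]_d -> \bar R)
    (openOmega : open Omega)
    (mk : measurable_fun [set: 'rV[R]_d * 'rV[R]_d] k)
    (k_ge0 : forall z, (0 <= k z)%E)
    (kSM : condSM k)
    (kK12 : condK12 k) :
  (forall u v : 'rV[R]_d -> 'rV[R]_d, Cc_smooth Omega u -> Cc_smooth Omega v ->
     [/\ forall n : nat, (0 < n)%N ->
           [/\ {ae @lebesgue_rV R d, forall x, Ln_defined k n u x},
               L2pair_defined (Ln k n u) v,
               Fn_defined k n u v &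
               L2pair (Ln k n u) v = Fn k n u v],
         Fform_defined k u v &
         Fn k n u v @[n --> \oo] --> Fform k u v]) /\
  [/\ forall u v : 'rV[R]_d -> 'rV[R]_d, Sspace k u -> Sspace k v ->
        Fform_defined k u v,
      form_continuous (Sspace k) (Snorm k) (Fform k) &
      form_continuous (Sspace_on k Omega) (Snorm k) (Fform k)].
Proof.
have Fd := Sspace_Fform_defined k mk k_ge0 kK12.
split; last first.
  split => //.
  - exact: Fform_continuous.
  - by apply: Fform_continuous => // v [].
move=> u v uO vO.
have Su := Cc_smooth_Sspace k mk k_ge0 kSM Omega u uO.
have Sv := Cc_smooth_Sspace k mk k_ge0 kSM Omega v vO.
have [mu _ _ [C C0 uC]] := Cc_smooth_estimate Omega u uO.
have [mv [N v0] [M M0 vM] _] := Cc_smooth_estimate Omega v vO.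
have {}uC z : Dop u z ^+ 2 <= C.
  by rewrite (le_trans (uC z))// ler_piMr// ge_min lexx.
have nF n : (0 < n)%N -> Fn_defined k n u v.
  by move=> n0; exact: (Fn_definedP k mk k_ge0 kSM u v N C M).
have Fcvg := cvg_Fn k mk k_ge0 u v Su Sv (Fd u v Su Sv) nF.
split; [|exact: Fd|exact: Fcvg].
move=> n n0.
have [LD LE] := L2pair_Ln k mk k_ge0 kSM u v N C M mu mv C0 uC v0 M0 vM n n0.
have LA := ae_Ln_defined k mk k_ge0 kSM u C mu C0 uC n n0.
by split; [exact: LA|exact: LD|exact: nF|exact: LE].
Qed.
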